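(* There exist groups $G_1,G_2\leq\mathrm{Isom}(\mathbb{H}^\infty)$, each of which is convex-cobounded, nonplanar, and of the second kind, such that $\Lambda(G_1)=\Lambda(G_2)$ and $G_1\cap G_2=\{\mathrm{id}\}$. In particular, $G_1$ and $G_2$ are not commensurable.
   Context: $\mathbb{H}^\infty$ denotes infinite-dimensional real hyperbolic space (modelled on a separable infinite-dimensional Hilbert space), with hyperbolic metric $\mathrm{dist}$, boundary at infinity $\partial\mathbb{H}^\infty$, isometry group $\mathrm{Isom}(\mathbb{H}^\infty)$, and a fixed basepoint $\mathbf{0}\in\mathbb{H}^\infty$. $B(\mathbf{0},\sigma)$ is the ball of radius $\sigma$ about $\mathbf{0}$, and for a set $A$, $G(A)=\bigcup_{g\in G}g(A)$. A group $G\leq\mathrm{Isom}(\mathbb{H}^\infty)$ is strongly discrete if $\#\{g\in G:\mathrm{dist}(\mathbf{0},g(\mathbf{0}))\leq R\}<\infty$ for all $R>0$. The limit set of $G$ is $\Lambda(G)=\{\xi\in\partial\mathbb{H}^\infty:\ \text{there is a sequence } (g_n)_{n\ge 1}\text{ in } G \text{ with } g_n(\mathbf{0})\to\xi\}$. $G$ is nonelementary if $\Lambda(G)$ contains at least three points. $G$ is of the second kind if $\Lambda(G)\neq\partial\mathbb{H}^\infty$. $G$ is nonplanar if it preserves neither any nonempty proper closed totally geodesic subspace of $\mathbb{H}^\infty$ nor any point of $\partial\mathbb{H}^\infty$. A set $A\subset\mathbb{H}^\infty$ is convex if it contains the geodesic segment connecting any two of its points. For $G$ nonelementary, $\mathcal{C}(G)$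 denotes the convex hull of the limit set: the smallest closed convex subset of $\mathbb{H}^\infty$ whose closure in $\mathbb{H}^\infty\cup\partial\mathbb{H}^\infty$ contains $\Lambda(G)$. A strongly discrete group $G$ is convex-cobounded if there exists $\sigma>0$ such that $\mathcal{C}(G)\subset G(B(\mathbf{0},\sigma))$. Two groups $G_1,G_2$ are commensurable if $G_1\cap G_2$ has finite index in both $G_1$ and $G_2$. *)

(* Defs.v *)
From HB Require Import structures.
From mathcomp Require Import all_boot all_order all_algebra.
From mathcomp Require Import all_classical all_reals all_analysis.
Set Implicit Arguments.
Unset Strict Implicit.
Unset Printing Implicit Defensive.
Import Order.TTheory GRing.Theory Num.Theory.
Import numFieldNormedType.Exports.
Local Open Scope classical_set_scope.
Local Open Scope ring_scope.

Definition inner_product (R : realType) (E : normedModType R)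
    (ip : E -> E -> R) : Prop :=
  [/\ forall x y, ip x y = ip y x,
      forall (a : R) x y z, ip (a *: x + y) z = a * ip x z + ip y z
    & forall x, ip x x = `|x| ^+ 2].

Definition separable (T : topologicalType) : Prop :=
  exists2 D : set T, countable D & dense D.

Definition infinite_dimensional (R : realType) (E : lmodType R) : Prop :=
  ~ exists (n : nat) (v : 'I_n -> E),
      forall x : E, exists c : 'I_n -> R, x = \sum_i c i *: v i.

Definition acosh (R : realType) (t : R) : R := ln (t + Num.sqrt (t ^+ 2 - 1)).

(* H^oo in the projective (Klein) model attached to the quadratic form
   Q(t, x) = |x|^2 - t^2 on R (+) E: the point x of the open unit ball stands
   for the timelike line through (1, x), and the unit vector xi, a point at
   infinity, for the isotropic line through (1, xi).  The bordification
   H^oo u dH^oo is thus the closed unit ball of E with the norm topology.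
   As a type, [hball E] carries the subspace topology. *)
Definition hball (R : realType) (E : normedModType R) : set E :=
  [set x | `|x| < 1].
Arguments hball {R} E.

Definition hboundary (R : realType) (E : normedModType R) : set E :=
  [set x | `|x| = 1].
Arguments hboundary {R} E.

Lemma hball_origin (R : realType) (E : normedModType R) : (0 : E) \in hball E.
Proof. by rewrite inE /hball /= normr0 ltr01. Qed.

Definition origin (R : realType) (E : normedModType R) : hball E :=
  exist _ 0 (hball_origin E).
Arguments origin {R} E.

Section Hyperbolic.
Context {R : realType} {E : normedModType R} (ip : E -> E -> R).
Notation H := (hball E).
Implicit Types (x y : H) (A S : set H) (G : set (H -> H)) (g : H -> H).

(* cosh dist([u], [v]) = |B(u, v)| / sqrt(|Q(u)| |Q(v)|) for u = (1, x) and
   v = (1, y), where B is the polarization of Q. *)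
Definition hdist x y : R :=
  acosh ((1 - ip (set_val x) (set_val y)) /
         (Num.sqrt (1 - `|set_val x| ^+ 2) * Num.sqrt (1 - `|set_val y| ^+ 2))).

Definition Isom : set (H -> H) :=
  [set g | bijective g /\ forall x y, hdist (g x) (g y) = hdist x y].

Definition isom_group G : Prop :=
  [/\ G `<=` Isom, G id, forall g h, G g -> G h -> G (g \o h)
    & forall g, G g -> exists2 h, G h & cancel g h /\ cancel h g].

Definition geodesic_on (I : set R) (gamma : R -> H) : Prop :=
  forall s t, I s -> I t -> hdist (gamma s) (gamma t) = `|s - t|.

Definition geodesic_segment x y : set H :=
  [set z | exists (gamma : R -> H) (l : R),
    [/\ geodesic_on `[0, l] gamma, gamma 0 = x, gamma l = y
      & exists2 t, 0 <= t <= l & z = gamma t]].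

Definition hconvex A : Prop :=
  forall x y, A x -> A y -> geodesic_segment x y `<=` A.

(* Points are totally geodesic subspaces (of dimension 0), as is the empty
   set. *)
Definition totally_geodesic S : Prop :=
  closed S /\
  forall gamma : R -> H, geodesic_on setT gamma ->
    forall s t, s != t -> S (gamma s) -> S (gamma t) -> forall r, S (gamma r).

(* The continuous extension of [g] to the boundary maps [xi] to [eta]. *)
Definition boundary_map g (xi eta : E) : Prop :=
  forall u : nat -> H, set_val (u n) @[n --> \oo] --> xi ->
    set_val (g (u n)) @[n --> \oo] --> eta.

Definition strongly_discrete G : Prop :=
  forall r : R, 0 < r ->
    finite_set [set g | G g /\ hdist (origin E) (g (origin E)) <= r].

Definition limit_set G : set E :=
  [set xi | hboundary E xi /\
    exists2 g : nat -> (H -> H), forall n, G (g n)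
      & set_val (g n (origin E)) @[n --> \oo] --> xi].

Definition nonelementary G : Prop :=
  exists a b c : E,
    [/\ limit_set G a, limit_set G b & limit_set G c] /\
    [/\ a != b, b != c & a != c].

Definition second_kind G : Prop := limit_set G <> hboundary E.

Definition nonplanar G : Prop :=
  (~ exists S, [/\ S !=set0, S != setT, totally_geodesic S
                 & forall g, G g -> g @` S = S]) /\
  (~ exists2 xi : E, hboundary E xi & forall g, G g -> boundary_map g xi xi).

Definition convex_hull G : set H :=
  \bigcap_(A in [set A : set H | [/\ closed A, hconvex A
                  & limit_set G `<=` closure (set_val @` A)]]) A.

Definition orbit_of G A : set H := \bigcup_(g in G) (g @` A).

Definition convex_cobounded G : Prop :=
  [/\ strongly_discrete G, nonelementary G
    & exists2 sigma : R, 0 < sigma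
        & convex_hull G `<=` orbit_of G [set x | hdist (origin E) x < sigma]].

End Hyperbolic.

(* [K] has finitely many left cosets in [G]. *)
Definition finite_index (T : Type) (K G : set (T -> T)) : Prop :=
  finite_set [set [set g \o k | k in K] | g in G].

Definition commensurable (T : Type) (G1 G2 : set (T -> T)) : Prop :=
  finite_index (G1 `&` G2) G1 /\ finite_index (G1 `&` G2) G2.

(* Main.v *)
(* The two groups come from two free products of three copies of Z/2, both
   acting simply transitively on the vertices of the 3-regular tree T: the group
   of label-preserving automorphisms and its conjugate by an automorphism which
   fixes one half-tree and exchanges two labels on the other.  They meet
   trivially because an element of the intersection must preserve that half-tree.

   Every automorphism of T extends to an isometry once T is embedded in H^oo so
   that cosh dist(p v, p w) = phi(d(v, w)).  The kernel lambda^d will not do: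
   flows on T show that the ends of T then span a proper subspace.  With phi a
   spherical function of T the vertex vectors satisfy
   sum_(w adjacent to v) P w = 3 kappa P v and already lie in the closed span of
   the ends, which yields nonplanarity.  The limit set and its hull depend only
   on the orbit p(T) of the origin, hence agree for the two groups. *)
Require Import Defs.
From HB Require Import structures.
From mathcomp Require Import all_boot all_order all_algebra.
From mathcomp Require Import all_classical all_reals all_analysis.
From mathcomp Require Import lra zify.
Set Implicit Arguments.
Unset Strict Implicit.
Unset Printing Implicit Defensive.
Import Order.TTheory GRing.Theory Num.Theory.
Import numFieldNormedType.Exports.

(** * The 3-regular tree *)

(** Such an embedding exists only if the kernel phi(|v|) phi(|w|) - phi(d(v, w)) is positive
    semidefinite. This is obtained by construction: harmonicity prescribes the mean of the children
    of a vertex, and one fresh basis vector per vertex separates the two children. For kappa = 3/2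
    the radial recursion 2 phi(n+2) + phi(n) = 9/2 phi(n+1) has the rational roots 2 and 1/4, so
    every estimate is rational arithmetic.

    The hull is never described. A half-space containing all but finitely many vertices has the
    limit set in its closure, hence contains the hull; so a linear inequality between the functions
    cosh d(., v) that holds at the vertices, suitably lifted, also holds at each point x of the
    hull. Two such inequalities, applied at a vertex nearly closest to x, bound its distance to x.

    The orbit alone does not exclude a fixed point at infinity. There the groups enter through their
    involutions, which generate them. *)

Definition letter := option bool.

Definition reduced (s : seq letter) : bool := sorted (fun x y => x != y) s.

(* Vertices of the 3-regular tree are the reduced words of the free product of
   three copies of Z/2, stored with the last letter at the head: the parent of
   a vertex is then its tail. *)
Record word := Word { letters :> seq letter; letters_reduced : reduced letters }.
HB.instance Definition _ := [isSub for letters].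
HB.instance Definition _ := [Countable of word by <:].

Definition tree_root : word := @Word [::] isT.

Definition seq_step (x : letter) (s : seq letter) : seq letter :=
  if s is y :: t then (if x == y then t else x :: s) else [:: x].

Lemma reduced_step x s : reduced s -> reduced (seq_step x s).
Proof.
case: s => //= y t st; case: eqVneq => [_|xy]; first exact: path_sorted st.
by rewrite /reduced /= xy.
Qed.

Definition step x (v : word) : word :=
  Word (reduced_step x (letters_reduced v)).

Lemma letters_inj : injective letters. Proof. exact: val_inj. Qed.

Lemma letters_step x (v : word) : letters (step x v) = seq_step x v.
Proof. by []. Qed.

Lemma stepK x : involutive (step x).
Proof.
move=> [s rs]; apply: letters_inj; rewrite !letters_step /=.
case: s rs => [|y t] /= rs; first by rewrite eqxx.
case: (eqVneq x y) => [xy|xy] /=; last by rewrite eqxx.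
by case: t rs => [|z t] /=; rewrite -xy // /reduced /= => /andP[/negPf ->].
Qed.

Lemma step_letter_inj v x y : step x v = step y v -> x = y.
Proof.
move=> /(congr1 letters); rewrite !letters_step.
case: v => [[|z t] rs] /=; first by case.
case: (eqVneq x z) => [->|xz]; case: (eqVneq y z) => [->|yz] //.
- by move/(congr1 size) => /=; lia.
- by move/(congr1 size) => /=; lia.
- by case.
Qed.

Lemma word_ind (P : word -> Prop) :
  P tree_root -> (forall x v, P v -> P (step x v)) -> forall v, P v.
Proof.
move=> P0 PS [s rs]; elim: s rs => [|x s IH] rs.
  by rewrite (_ : Word rs = tree_root) //; apply: letters_inj.
have rs' : reduced s by exact: path_sorted rs.
rewrite (_ : Word rs = step x (Word rs')); first exact: PS.
apply: letters_inj; rewrite letters_step /=.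
by case: s rs {IH rs'} => [|y t] //= /andP[/negPf ->].
Qed.

Fixpoint level_dist (s t : seq letter) : nat :=
  if s is x :: s' then
    if t is y :: t' then (if s == t then 0 else (level_dist s' t').+2) else 0
  else 0.

(** The path distance: climb from the deeper vertex to the depth of the other, then from both at
    once until they meet in their longest common suffix. *)
Definition tdist (s t : seq letter) : nat :=
  (size s - size t) + (size t - size s) +
  level_dist (drop (size s - size t) s) (drop (size t - size s) t).

Lemma level_distC s t : level_dist s t = level_dist t s.
Proof. by elim: s t => [|x s IH] [|y t] //=; rewrite eq_sym IH. Qed.

Lemma tdistC s t : tdist s t = tdist t s.
Proof. by rewrite /tdist level_distC [(size s - size t) + _]addnC. Qed.

Lemma tdist_consl x s t : size t <= size s -> tdist (x :: s) t = (tdist s t).+1.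
Proof.
move=> ts; rewrite /tdist [size (x :: s)]/= subSn // drop_cons.
have -> : size t - (size s).+1 = 0 by lia.
have -> : size t - size s = 0 by lia.
by rewrite !addn0 addSn.
Qed.

Lemma tdist_consr y s t : size s <= size t -> tdist s (y :: t) = (tdist s t).+1.
Proof. by move=> st; rewrite tdistC tdist_consl // tdistC. Qed.

Lemma tdist_cons x y s t : size s = size t ->
  tdist (x :: s) (y :: t) =
  if (x :: s == y :: t) then 0 else (tdist s t).+2.
Proof. by move=> st; rewrite /tdist ![size (_ :: _)]/= st !subnn !drop0. Qed.

Lemma tdist0s s : tdist [::] s = size s.
Proof. by elim: s => // x s IH; rewrite tdist_consr // IH. Qed.

Lemma tdists0 s : tdist s [::] = size s.
Proof. by rewrite tdistC tdist0s. Qed.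

Lemma tdistss s : tdist s s = 0.
Proof. by case: s => // x s; rewrite tdist_cons // eqxx. Qed.

Lemma tdist_eq0 s t : tdist s t = 0 -> s = t.
Proof.
case: (ltngtP (size s) (size t)) => [||st]; first by rewrite /tdist; lia.
  by rewrite /tdist; lia.
move: st; case: s t => [|x s] [|y t] //= [st]; rewrite tdist_cons //.
by case: eqP.
Qed.

Lemma tdist_cons_adj x s t :
  tdist s (x :: t) = (tdist s t).+1 \/ tdist s t = (tdist s (x :: t)).+1.
Proof.
elim: s => [|y s IH]; first by left; rewrite !tdist0s.
case: (ltngtP (size t) (size s)) => st.
- by rewrite !tdist_consl //; [case: IH => ->; [left|right]|lia].
- by left; rewrite tdist_consr.
- rewrite tdist_cons // tdist_consl ?st //.
  by case: eqP => [[_ ->]|_]; [right; rewrite tdistss|left].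
Qed.

Lemma tdist_step v x (w : word) : tdist v (step x w) <= (tdist v w).+1.
Proof.
rewrite letters_step /seq_step; case: w => [[|y t] rs] /=.
  by case: (tdist_cons_adj x v [::]); lia.
case: eqP => _; first by case: (tdist_cons_adj y v t); lia.
by case: (tdist_cons_adj x v (y :: t)); lia.
Qed.

Lemma tdist_behead s y t : size s <= (size t).+1 -> s != y :: t ->
  tdist s (y :: t) = (tdist s t).+1.
Proof.
rewrite leq_eqVlt => /orP[/eqP|lt_st _]; last by rewrite tdist_consr.
case: s => //= x s [st] ne; rewrite tdist_cons // (negPf ne).
by rewrite tdist_consl ?st.
Qed.

(** With [tdist_step] this identifies [tdist] as a path metric. The step goes to the parent of [w]
    unless [v] lies below [w]. *)
Lemma tdist_closer (v w : word) : v != w ->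
  exists x, tdist v w = (tdist v (step x w)).+1.
Proof.
case: v w => s rs; elim: s rs => [|x s IH] rs w.
  case: w => [[|y t] rt] ne; first by move: ne; rewrite -val_eqE.
  by exists y; rewrite letters_step /= eqxx !tdist0s.
move=> ne; case: w ne => t rt; rewrite -val_eqE /= => ne.
case: (leqP (size s) (size t)) => [st|ts].
  case: t rt ne st => [|y t] rt ne st.
    by exists x; case: s st {IH ne rs} => //= _; rewrite tdistss.
  have [ts|] := leqP (size s) (size t).
    by exists y; rewrite /= eqxx tdist_behead.
  move=> ts; have {st ts}st : size s = (size t).+1 by apply/eqP;
    rewrite eqn_leq st ts.
  rewrite tdist_consl ?st //=.
  have [E|sne] := eqVneq s (y :: t).
    (* Here [w] is the parent of [v], and the step leads down to [v]. *)
    exists x; rewrite /= -E; move: rs; rewrite E /reduced /=.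
    by case/andP => /negPf -> _; rewrite !tdistss.
  exists y; rewrite /= eqxx tdist_consl ?st //.
  by rewrite tdist_behead // st.
(* Now [v] is at least two levels deeper than [w]: a step that approaches the parent of [v] also
   approaches [v]. *)
have rs' : reduced s by exact: path_sorted rs.
have /IH : Word rs' != Word rt by rewrite -val_eqE; apply: contraTneq ts =>
  /= ->; rewrite ltnn.
move=> [z] /= E; exists z.
rewrite /= !tdist_consl ?E //; last exact: ltnW.
by case: t rt ts {ne E} => [|y t] _ //=; case: eqP => //= _; lia.
Qed.

(** * Automorphisms of the tree *)

Definition tree_aut (f : word -> word) : Prop :=
  bijective f /\ forall v w, tdist (f v) (f w) = tdist v w.

(** Induction along a geodesic: a map sending edges to edges does not lengthen paths. Applied to the
    inverse as well, this yields [tree_aut_local]. *)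
Lemma tdist_local_contract (f : word -> word) (s : word -> letter -> letter) :
  (forall x v, f (step x v) = step (s v x) (f v)) ->
  forall v w, tdist (f v) (f w) <= tdist v w.
Proof.
move=> fs v w; elim: (tdist v w) {-2}w (erefl (tdist v w)) => {w} [|n IH] w E.
  by move/tdist_eq0/letters_inj: E => ->; rewrite !tdistss.
have [x Ex] : exists x, tdist v w = (tdist v (step x w)).+1.
  by apply: tdist_closer; apply/eqP => vw; rewrite vw tdistss in E.
have /IH le_n : tdist v (step x w) = n by move: Ex; rewrite E => -[].
have -> : f w = step (s (step x w) x) (f (step x w)) by rewrite -fs stepK.
by apply: leq_trans (tdist_step _ _ _) _; rewrite Ex ltnS.
Qed.

Lemma tree_aut_local f g s t :
  (forall x v, f (step x v) = step (s v x) (f v)) ->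
  (forall x v, g (step x v) = step (t v x) (g v)) ->
  cancel f g -> cancel g f -> tree_aut f.
Proof.
move=> fs gt fg gf; split; first by exists g.
move=> v w; apply/eqP; rewrite eqn_leq (tdist_local_contract fs) /=.
by rewrite -{1}(fg v) -{1}(fg w) (tdist_local_contract gt).
Qed.

Lemma tree_aut_comp f g : tree_aut f -> tree_aut g -> tree_aut (f \o g).
Proof.
move=> [bf df] [bg dg]; split; first exact: bij_comp.
by move=> v w /=; rewrite df dg.
Qed.

(** A step multiplies by a letter on the right, so these maps are the left translations of the free
    product. *)
Definition label_preserving (f : word -> word) : Prop :=
  forall x v, f (step x v) = step x (f v).

Lemma label_preserving_ext f g v : label_preserving f -> label_preserving g ->
  f v = g v -> f =1 g.
Proof.
move=> cf cg; have key u : (f u = g u) <-> (f tree_root = g tree_root).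
  elim/word_ind: u => // x u [IH1 IH2]; rewrite cf cg; split => [|/IH2 -> //].
  by move/(can_inj (stepK x)).
by move=> /key E w; apply/key.
Qed.

(** The product of [u] and [v] in the free product: as words are stored backwards, [foldr] applies
    the first letter of [v] first. *)
Definition lmul (u v : word) : word := foldr step u v.

Lemma lmul_label_preserving u : label_preserving (lmul u).
Proof.
move=> x v; rewrite /lmul letters_step /seq_step; case: v => [[|y t] r] //=.
by case: eqP => [->|_] //=; rewrite stepK.
Qed.

Lemma label_preserving_trans v w :
  exists2 f, label_preserving f & f v = w.
Proof.
have [f cf fv] : exists2 f, label_preserving f & f v = tree_root.
  elim/word_ind: v => [|x v [f cf fv]]; first by exists id.
  exists (lmul (step x tree_root) \o f); last first.
    by rewrite /= cf fv lmul_label_preserving /lmul /= stepK.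
  by move=> y u /=; rewrite cf lmul_label_preserving.
exists (lmul w \o f); last by rewrite /= fv.
by move=> y u /=; rewrite cf lmul_label_preserving.
Qed.

Lemma label_preserving_inv f : label_preserving f ->
  exists g, [/\ label_preserving g, cancel f g & cancel g f].
Proof.
move=> cf; have [g cg gf] := label_preserving_trans (f tree_root) tree_root.
have cid : label_preserving id by [].
exists g; split => // v.
- apply: (@label_preserving_ext (g \o f) id tree_root) => //.
  by move=> x u /=; rewrite cf cg.
- apply: (@label_preserving_ext (f \o g) id (f tree_root)) => //=;
  last by rewrite gf.
  by move=> x u /=; rewrite cg cf.
Qed.

Lemma label_preserving_aut f : label_preserving f -> tree_aut f.
Proof.
move=> cf; have [g [cg fg gf]] := label_preserving_inv cf.
exact: (@tree_aut_local f g (fun _ => id) (fun _ => id)).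
Qed.

(** * The twisted group *)

Definition swap_letter : letter -> letter := omap negb.

Lemma swapK : involutive swap_letter. Proof. by case=> [[]|]. Qed.

(** [last] reads the first letter of the word, so this is the half-tree behind the edge [None] at
    the root. The default value leaves the root outside. *)
Definition in_half (s : seq letter) : bool := last (Some true) s == None.

Definition seq_twist (s : seq letter) : seq letter :=
  if in_half s then s else map swap_letter s.

Lemma reduced_twist s : reduced s -> reduced (seq_twist s).
Proof.
rewrite /seq_twist; case: ifP => // _.
rewrite /reduced sorted_map; apply: sub_sorted => x y /=.
by rewrite (can_eq swapK).
Qed.

Definition twist (v : word) : word := Word (reduced_twist (letters_reduced v)).

Lemma in_half_twist v : in_half (twist v) = in_half v.
Proof.
rewrite /twist /= /seq_twist; case: ifP => // nh; rewrite -nh /in_half.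
by case: (letters v) => //= x s; rewrite last_map -[RHS](can_eq swapK).
Qed.

Lemma twistK : involutive twist.
Proof.
move=> v; apply: letters_inj; rewrite {1}/twist /= {1}/seq_twist in_half_twist.
by rewrite /seq_twist; case: (in_half v) => //; rewrite (mapK swapK).
Qed.

Definition twist_label (v : word) (x : letter) : letter :=
  if in_half v then x else swap_letter x.

(** The two halves are joined by a single edge. Its label [None] is fixed by [swap_letter], so the
    two definitions of [twist] agree across it. *)
Lemma twist_step x v : twist (step x v) = step (twist_label v x) (twist v).
Proof.
apply: letters_inj; rewrite /= /twist_label /seq_twist /seq_step.
case: v => [[|y t] r] /=; first by case: x => [[]|].
case: (eqVneq x y) => [->|xy].
  by case: t r => [|z t] r; rewrite /in_half /=; case: ifP; rewrite /= eqxx.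
by rewrite /in_half /=; case: ifP => _ /=; rewrite ?(can_eq swapK) (negPf xy).
Qed.

Lemma twist_aut : tree_aut twist.
Proof. exact: (tree_aut_local twist_step twist_step twistK twistK). Qed.

(** [st_involutions] expresses that the involutions of [X] generate a transitive group, in the form
    used later: a function invariant under them is constant. *)
Record simply_transitive (X : (word -> word) -> Prop) : Prop := {
  st_aut : forall f, X f -> tree_aut f;
  st_id : X id;
  st_comp : forall f g, X f -> X g -> X (f \o g);
  st_inv : forall f, X f -> exists g, [/\ X g, cancel f g & cancel g f];
  st_trans : forall v, exists2 f, X f & f tree_root = v;
  st_free : forall f g, X f -> X g -> f tree_root = g tree_root -> f =1 g;
  st_involutions : forall (T : Type) (F : word -> T),
    (forall f, X f -> involutive f -> forall v, F (f v) = F v) ->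
    forall v, F v = F tree_root }.

Lemma label_preserving_simply_transitive : simply_transitive label_preserving.
Proof.
split=> //.
- exact: label_preserving_aut.
- by move=> f g cf cg x v /=; rewrite cg cf.
- exact: label_preserving_inv.
- exact: label_preserving_trans.
- by move=> f g cf cg; apply: label_preserving_ext.
- move=> T F FX v; elim/word_ind: v => // x v <-.
  (* The translation along an edge exchanges its two ends, so its square fixes a vertex and is the
     identity. *)
  have [f cf fv] := label_preserving_trans v (step x v).
  rewrite -fv; apply: FX => //.
  apply: (@label_preserving_ext (f \o f) id v) => //=; last first.
    by rewrite fv cf fv stepK.
  by move=> y u /=; rewrite !cf.
Qed.

Definition twisted (f : word -> word) : Prop :=
  label_preserving (twist \o f \o twist).

Lemma twisted_conj f : label_preserving f -> twisted (twist \o f \o twist).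
Proof. by move=> cf x v /=; rewrite !twistK cf. Qed.

Lemma twist_root : twist tree_root = tree_root. Proof. exact: letters_inj. Qed.

Lemma twisted_simply_transitive : simply_transitive twisted.
Proof.
have conjE f v : f v = twist ((twist \o f \o twist) (twist v)).
  by rewrite /= !twistK.
split=> //.
- move=> f /label_preserving_aut af.
  have /= [bf df] := tree_aut_comp (tree_aut_comp twist_aut af) twist_aut.
  have fE : twist \o (twist \o f \o twist) \o twist =1 f.
    by move=> v /=; rewrite !twistK.
  split; first exact: eq_bij bf _ fE.
  by move=> v w; rewrite -!fE df.
- by move=> x v /=; rewrite !twistK.
- move=> f g cf cg x v /=.
  by rewrite -[g _]twistK -[twist (g _)]/((twist \o g \o twist) _) cg
    -[LHS]/((twist \o f \o twist) _) cf /= twistK.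
- move=> f /label_preserving_inv[g [cg fg gf]].
  exists (twist \o g \o twist); split; first exact: twisted_conj.
  + by move=> v; rewrite (conjE f) /= !twistK; have /= := fg (twist v);
    rewrite twistK => ->; rewrite twistK.
  + by move=> v; have /= := gf (twist v); rewrite /= => /(congr1 twist);
    rewrite !twistK.
- move=> v; have [f cf fv] := label_preserving_trans tree_root (twist v).
  exists (twist \o f \o twist); first exact: twisted_conj.
  by rewrite /= twist_root fv twistK.
- move=> f g cf cg E v; rewrite (conjE f) (conjE g); congr twist.
  by apply: (label_preserving_ext (v := tree_root)) => //=; rewrite twist_root E.
- move=> T F FX v; rewrite -[v]twistK -[in RHS]twist_root.
  have := st_involutions label_preserving_simply_transitive (F := F \o twist).
  apply=> f cf ff u /=.
  have := FX _ (twisted_conj cf) _ (twist u); rewrite /= !twistK; apply.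
  by move=> w /=; rewrite twistK ff twistK.
Qed.

(** An edge labelled [Some true] keeps its label under the twist exactly at the vertices of the
    half-tree, so a map respecting both labellings preserves the half-tree. The root is the only
    vertex outside it whose [None]-neighbour lies inside, hence it is fixed. *)
Lemma label_preserving_twisted f : label_preserving f -> twisted f -> f =1 id.
Proof.
move=> cf tf; have half v : in_half (f v) = in_half v.
  have := tf (twist_label v (Some true)) (twist v).
  rewrite /= -twist_step !twistK cf twist_step => /step_letter_inj.
  by rewrite /twist_label; do 2 case: in_half.
apply: (label_preserving_ext (v := tree_root)) => //.
have := half tree_root; have := half (step None tree_root); rewrite cf.
case: (f tree_root) => [[|y t] r] /=; first by move=> *; apply: letters_inj.
case: y r => [b|] r; first by rewrite /in_half /= => ->.
by case: t r => [|y t] r; rewrite /in_half //= => ->.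
Qed.

(** * Separation of vertices and rays *)

Definition next_letter (x : letter) : letter :=
  match x with None => Some true | Some true => Some false | Some false => None end.

(** The first letters, stored at the end, differ, so the geodesic passes through the root. *)
Lemma tdist_bottom_neq (s t : seq letter) (x y : letter) : x != y ->
  tdist (rcons s x) (rcons t y) = (size s + size t).+2.
Proof.
move=> xy; have [n] := ubnP (size s + size t); elim: n s t => // n IH.
case=> [|a s] [|b t] /= le_n.
- by rewrite tdist_cons // eqseq_cons (negPf xy) tdistss.
- rewrite tdist_consr ?size_rcons //= -[[:: x]]/(rcons [::] x) IH //=.
- rewrite tdist_consl ?size_rcons //= -[[:: y]]/(rcons [::] y) IH //=; lia.
- case: (ltngtP (size s) (size t)) => st.
  + rewrite tdist_consr /= ?size_rcons // -rcons_cons IH //=; lia.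
  + rewrite tdist_consl /= ?size_rcons // -rcons_cons IH //=; lia.
  + rewrite tdist_cons ?size_rcons ?st //.
    rewrite eqseq_cons eqseq_rcons (negPf xy) !andbF IH; lia.
Qed.

Lemma tdist_bottom s x : tdist (rcons s x) [:: x] = size s.
Proof.
elim: s => [|a s IH] /=; first by rewrite tdistss.
by rewrite tdist_consl ?size_rcons // IH.
Qed.

(** After a translation of [v0] to the root, [a] is the neighbour given by the first letter of [v].
    A word [w] with the same first letter is closer to [a]; for any other, [v0] separates [w] from
    [v]. *)
Lemma tdist_toward (v0 v : word) : v0 != v -> exists a : word,
  forall w : word,
    tdist w v0 = (tdist w a).+1 \/
    (tdist w a = (tdist w v0).+1 /\ tdist w v = tdist w v0 + tdist v0 v).
Proof.
have [f cf fv0] := label_preserving_trans v0 tree_root.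
have [_ df] := label_preserving_aut cf; have [g [_ fg gf]] :=
  label_preserving_inv cf.
rewrite -(can_eq fg) fv0 => vN.
have [t [x fvE]] : exists t x, letters (f v) = rcons t x.
  case: (f v) vN => [s r]; rewrite -val_eqE /=.
  by case/lastP: s r => // t x _ _; exists t, x.
exists (g (step x tree_root)) => w.
rewrite -(df w v0) -(df w (g _)) -(df w v) -(df v0 v) fv0 gf fvE letters_step /=.
rewrite tdists0 tdist0s; case/lastP: (letters (f w)) => [|s y].
  by right; rewrite !tdist0s.
have [->|yx] := eqVneq y x; first by left; rewrite tdist_bottom size_rcons.
right; rewrite -{1}[[:: x]]/(rcons [::] x) !tdist_bottom_neq // !size_rcons /=; lia.
Qed.

Lemma tdist_le (s t : seq letter) : tdist s t <= size s + size t.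
Proof.
have [n] := ubnP (size s + size t); elim: n s t => // n IH.
case=> [|a s] [|b t] le_n; rewrite ?tdists0 ?tdist0s ?addn0 //.
move: le_n => /= le_n; case: (ltngtP (size s) (size t)) => st.
- by rewrite tdist_consr // (leq_ltn_trans (IH _ _ _)) //=; lia.
- by rewrite tdist_consl // (leq_ltn_trans (IH _ _ _)) //=; lia.
- by rewrite tdist_cons //; case: ifP => // _; have := IH s t; lia.
Qed.

Fixpoint ray_seq (x : letter) (n : nat) : seq letter :=
  if n is m.+1 then (if odd m then next_letter x else x) :: ray_seq x m else [::].

Lemma next_letter_neq x : x != next_letter x.
Proof. by case: x => [[]|]. Qed.

Lemma reduced_ray x n : reduced (ray_seq x n).
Proof.
elim: n => // -[|n] // IH; have := next_letter_neq x.
rewrite /reduced /= in IH *; rewrite IH andbT.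
by case: (odd n) => //=; rewrite eq_sym.
Qed.

Definition ray x n : word := Word (reduced_ray x n).

Lemma size_ray x n : size (ray x n) = n.
Proof. by elim: n => //= n ->. Qed.

Lemma tdist_ray x n k : tdist (ray x (n + k)) (ray x n) = k.
Proof.
elim: k => [|k IH]; first by rewrite addn0 tdistss.
rewrite addnS [letters _]/= tdist_consl; first by rewrite IH.
by rewrite -[size _]/(size (ray x n)) -[in leqRHS]/(letters (ray x (n +
  k))) !size_ray leq_addr.
Qed.

Lemma tdist_ray_neq x y n m : x != y -> tdist (ray x n) (ray y m) = n + m.
Proof.
have bottom z k : exists s, size s = k /\ letters (ray z k.+1) = rcons s z.
  elim: k => [|k [s [sk IH]]]; first by exists [::].
  exists ((if odd k.+1 then next_letter z else z) :: s); split;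
    first by rewrite /= sk.
  by rewrite rcons_cons -IH.
case: n => [|n] xy; first by rewrite tdist0s size_ray.
case: m => [|m]; first by rewrite tdists0 size_ray addn0.
have [s [sn ->]] := bottom x n; have [t [tm ->]] := bottom y m.
by rewrite tdist_bottom_neq // sn tm addSn addnS.
Qed.

Local Open Scope classical_set_scope.
Local Open Scope ring_scope.

Section Hyperbolic.
Context {R : realType} {E : completeNormedModType R} {ip : E -> E -> R}.
Context (ip_inner : inner_product ip).

(** * Hilbert space *)

Lemma ipC x y : ip x y = ip y x. Proof. by case: ip_inner. Qed.

Lemma ipxx x : ip x x = `|x| ^+ 2. Proof. by case: ip_inner. Qed.

Lemma ipDl x y z : ip (x + y) z = ip x z + ip y z.
Proof. by case: ip_inner => _ H _; have := H 1 x y z; rewrite scale1r mul1r. Qed.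

Lemma ip0l z : ip 0 z = 0.
Proof. by have := ipDl 0 0 z; rewrite addr0 => /eqP;
  rewrite addrC -subr_eq subrr => /eqP. Qed.

Lemma ipZl a x z : ip (a *: x) z = a * ip x z.
Proof. by case: ip_inner => _ H _; have := H a x 0 z; rewrite addr0 ip0l addr0. Qed.

Lemma ipNl x z : ip (- x) z = - ip x z.
Proof. by rewrite -scaleN1r ipZl mulN1r. Qed.

Lemma ip0r z : ip z 0 = 0. Proof. by rewrite ipC ip0l. Qed.
Lemma ipDr x y z : ip z (x + y) = ip z x + ip z y.
Proof. by rewrite ipC ipDl !(ipC z). Qed.
Lemma ipZr a x z : ip z (a *: x) = a * ip z x.
Proof. by rewrite ipC ipZl ipC. Qed.
Lemma ipNr x z : ip z (- x) = - ip z x.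
Proof. by rewrite ipC ipNl ipC. Qed.

Definition ipE := (ipDl, ipDr, ipNl, ipNr, ipZl, ipZr, ip0l, ip0r).

Lemma ip_suml (I : Type) (r : seq I) (P : pred I) (F : I -> E) z :
  ip (\sum_(i <- r | P i) F i) z = \sum_(i <- r | P i) ip (F i) z.
Proof.
apply: (big_morph (fun x => ip x z)); last exact: ip0l.
by move=> x y; rewrite ipDl.
Qed.

Lemma ip_ge0 x : 0 <= ip x x. Proof. by rewrite ipxx sqr_ge0. Qed.

Lemma ip_eq0 x : ip x x = 0 -> x = 0.
Proof. by rewrite ipxx => /eqP; rewrite sqrf_eq0 normr_eq0 => /eqP. Qed.

Lemma ip_sqr_le x y : ip x y ^+ 2 <= ip x x * ip y y.
Proof.
have [/ip_eq0 ->|y0] := eqVneq (ip y y) 0; first by rewrite ip0r ip0r mulr0 expr0n.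
have yp : 0 < ip y y by rewrite lt_def y0 ip_ge0.
have := ip_ge0 (ip y y *: x - ip x y *: y).
rewrite !ipE (ipC y x) => H; rewrite -(ler_pM2l yp); nra.
Qed.

Lemma ip_norm_le x y : `|ip x y| <= `|x| * `|y|.
Proof.
rewrite -(@ler_pXn2r _ 2) ?nnegrE ?mulr_ge0 // exprMn -!ipxx real_normK ?num_real
  //.
exact: ip_sqr_le.
Qed.

Lemma ip_subxx x y : ip (x - y) (x - y) = ip x x - 2 * ip x y + ip y y.
Proof. by rewrite !ipE (ipC y x); lra. Qed.

Lemma cvg_norm_bound (V : normedModType R) (u : nat -> V) l (b : nat -> R) :
  (forall n, `|l - u n| <= b n) -> b @ \oo --> (0 : R) -> u @ \oo --> l.
Proof.
move=> ub /cvgrPdist_le b0; apply/cvgrPdist_le => e e0.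
have := b0 e e0; apply: filterS => n; rewrite sub0r normrN => bn.
exact: le_trans (ub n) (le_trans (ler_norm _) bn).
Qed.

Lemma ip_cvg (u v : nat -> E) x y : u @ \oo --> x -> v @ \oo --> y ->
  ip (u n) (v n) @[n --> \oo] --> ip x y.
Proof.
move=> ux vy.
have nu : (`|u n - x| : R) @[n --> \oo] --> (0 : R).
  by rewrite -(normr0 E) -(subrr x); apply: cvg_norm; apply: cvgB => //;
    exact: cvg_cst.
have nv : (`|v n - y| : R) @[n --> \oo] --> (0 : R).
  by rewrite -(normr0 E) -(subrr y); apply: cvg_norm; apply: cvgB => //;
    exact: cvg_cst.
have nvn : `|v n| @[n --> \oo] --> `|y| by apply: cvg_norm.
have b0 : `|u n - x| * `|v n| + `|x| * `|v n - y| @[n --> \oo] --> (0 : R).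
  rewrite -[0](addr0 0) -{1}(mul0r `|y|) -{2}(mulr0 `|x|).
  by apply: cvgD; apply: cvgM => //; exact: cvg_cst.
apply/cvgrPdist_le => e e0; move/cvgrPdist_le: b0 => /(_ e e0).
apply: filterS => n; rewrite sub0r normrN => bn;
  apply: le_trans (le_trans _ (ler_norm _)) bn.
have -> : ip x y - ip (u n) (v n) = - (ip (u n - x) (v n) + ip x (v n - y)).
  by rewrite !ipE; lra.
rewrite normrN; apply: le_trans (ler_normD _ _) _.
by apply: lerD; apply: ip_norm_le.
Qed.

Lemma cauchy_lim (u : nat -> E) :
  (forall e : R, 0 < e -> exists N, forall n m,
    (N <= n)%N -> (N <= m)%N -> `|u n - u m| < e) ->
  exists l : E, u @ \oo --> l.
Proof.
move=> uC; suff /cauchy_cvgP : cauchy (u @ \oo).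
  by move=> cu; exists (lim (u @ \oo)).
apply/cauchy_ballP => e e0; have [N NP] := uC e e0.
exists ([set x | exists2 n, (N <= n)%N & x = u n], [set x | exists2 n,
  (N <= n)%N & x = u n]).
  by split; exists N => // n /= Nn; exists n.
move=> [a b] /= [[n Nn ->] [m Nm ->]]; rewrite -ball_normE /=.
exact: NP.
Qed.

Definition comb (X : Type) (f : X -> E) (s : seq (R * X)) : E :=
  \sum_(c <- s) c.1 *: f c.2.

Definition spanning (X : Type) (f : X -> E) : Prop :=
  forall z (e : R), 0 < e -> exists s, `|z - comb f s| < e.

Lemma ip_comb (X : Type) (f : X -> E) s z :
  ip (comb f s) z = \sum_(c <- s) c.1 * ip (f c.2) z.
Proof. by rewrite ip_suml; apply: eq_bigr => c _; rewrite ipZl. Qed.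

Lemma comb_cat (X : Type) (f : X -> E) s t :
  comb f (s ++ t) = comb f s + comb f t.
Proof. by rewrite /comb big_cat. Qed.

Lemma comb_scale (X : Type) (f : X -> E) a s :
  a *: comb f s = comb f [seq (a * c.1, c.2) | c <- s].
Proof.
by rewrite /comb big_map scaler_sumr; apply: eq_bigr => c _; rewrite scalerA.
Qed.

Lemma comb1 (X : Type) (f : X -> E) x : comb f [:: (1, x)] = f x.
Proof. by rewrite /comb big_seq1 scale1r. Qed.

Lemma spanning_orth (X : Type) (f : X -> E) z :
  spanning f -> (forall x, ip z (f x) = 0) -> z = 0.
Proof.
move=> tf zf; apply/eqP; rewrite -normr_eq0; apply/negP => /negP z0.
have zp : 0 < `|z| by rewrite lt_def z0 normr_ge0.
have [s Hs] := tf z `|z| zp.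
have zs : ip z (comb f s) = 0.
  by rewrite ipC ip_comb big1 // => c _; rewrite ipC zf mulr0.
have := ip_sqr_le z (z - comb f s); rewrite ipDr ipNr zs subr0 !ipxx expr2.
have sq : `|z - comb f s| ^+ 2 < `|z| ^+ 2.
  by rewrite ltr_pXn2r // nnegrE.
have z2 : 0 < `|z| ^+ 2 by rewrite exprn_gt0.
by rewrite leNgt ltr_pM2l // sq.
Qed.

Lemma spanning_eq (X : Type) (f : X -> E) z z' :
  spanning f -> (forall x, ip z (f x) = ip z' (f x)) -> z = z'.
Proof.
move=> tf zz; apply/eqP; rewrite -subr_eq0; apply/eqP/(spanning_orth tf) => x.
by rewrite !ipE zz subrr.
Qed.

Lemma comb_span (X Y : Type) (f : X -> E) (g : Y -> E) s :
  (forall x, exists t, f x = comb g t) -> exists t, comb f s = comb g t.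
Proof.
move=> fg; elim: s => [|[a x] s [t st]].
  by exists [::]; rewrite /comb !big_nil.
have [t' xt'] := fg x; exists ([seq (a * c.1, c.2) | c <- t'] ++ t).
by rewrite comb_cat -comb_scale -xt' -st /comb big_cons.
Qed.

Lemma spanning_trans (X Y : Type) (f : X -> E) (g : Y -> E) : spanning f ->
  (forall x, exists t, f x = comb g t) -> spanning g.
Proof.
move=> tf fg z e e0; have [s Hs] := tf z e e0; have [t st] := comb_span s fg.
by exists t; rewrite -st.
Qed.

Lemma cvg_comb (X : Type) (f : X -> E) (z : E) : spanning f ->
  exists s : nat -> seq (R * X), comb f (s n) @[n --> \oo] --> z.
Proof.
move=> tf.
have [s Hs] : {s : nat -> seq (R * X) & forall n, `|z - comb f (s n)| < n.+1%:R^-1}.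
  apply: (choice (P := fun n s => `|z - comb f s| < n.+1%:R^-1)) => n.
  by apply: tf; rewrite invr_gt0 ltr0n.
exists s; apply: cvg_norm_bound (fun n => ltW (Hs n)) _.
exact: cvg_harmonic.
Qed.

(** * Linear isometries from equal Gram matrices *)

Section GramExtension.
Context {X : Type} (f f' : X -> E).
Context (gram : forall x y, ip (f x) (f y) = ip (f' x) (f' y)).

Lemma gram_comb s t : ip (comb f s) (comb f t) = ip (comb f' s) (comb f' t).
Proof.
rewrite !ip_comb; apply: eq_bigr => c _; congr (_ * _).
rewrite ipC [RHS]ipC !ip_comb; apply: eq_bigr => d _.
by rewrite gram.
Qed.

(** The graph of the isometry to be built: the same coefficients are used on both sides and pass to
    the limit. As a relation it needs no choice of approximating sequence. *)
Definition gram_rel (z y : E) : Prop := exists s : nat -> seq (R * X),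
  comb f (s n) @[n --> \oo] --> z /\ comb f' (s n) @[n --> \oo] --> y.

Lemma gram_rel_total z : spanning f -> exists y, gram_rel z y.
Proof.
move=> tf; have [s sz] := cvg_comb z tf.
suff [y sy] : exists y : E, comb f' (s n) @[n --> \oo] --> y by exists y, s.
apply: cauchy_lim => e e0.
have /cvgrPdist_lt /(_ (e / 2)) := sz; rewrite divr_gt0 // => /(_ isT)[N _ NP].
exists N => n m Nn Nm.
have -> : `|comb f' (s n) - comb f' (s m)| = `|comb f (s n) - comb f (s m)|.
  by apply/eqP; rewrite -(@eqrXn2 _ 2) // -!ipxx !ip_subxx !gram_comb.
rewrite -(subrKA z) [e]splitr; apply: le_lt_trans (ler_normD _ _) _.
by rewrite distrC; apply: ltrD; apply: NP.
Qed.

Lemma gram_rel_ip z y z' y' : gram_rel z y -> gram_rel z' y' -> ip y y' = ip z z'.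
Proof.
move=> [s [sz sy]] [t [tz ty]].
have A := ip_cvg sz tz; have B := ip_cvg sy ty.
have E1 : (fun n => ip (comb f (s n)) (comb f (t n))) = (fun n =>
  ip (comb f' (s n)) (comb f' (t n))).
  by apply/funext => n; rewrite gram_comb.
rewrite E1 in A; exact: (cvg_unique _ B A).
Qed.

Lemma gram_rel_base x : gram_rel (f x) (f' x).
Proof. by exists (fun=> [:: (1, x)]); rewrite !comb1; split; exact: cvg_cst. Qed.

(** One direction says that the relation is a function, the other that it is injective. *)
Lemma gram_rel_inj z y z' y' : gram_rel z y -> gram_rel z' y' -> (z =
  z') <-> (y = y').
Proof.
move=> zy zy'.
have E1 : ip (z - z') (z - z') = ip (y - y') (y - y').
  by rewrite !ip_subxx (gram_rel_ip zy zy) (gram_rel_ip zy zy') (gram_rel_ip zy'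
    zy').
split=> EQ; apply/eqP; rewrite -subr_eq0; apply/eqP/ip_eq0.
  by rewrite -E1 EQ subrr ip0r.
by rewrite E1 EQ subrr ip0r.
Qed.

End GramExtension.

Lemma gram_relC X (f f' : X -> E) z y : gram_rel f f' z y -> gram_rel f' f y z.
Proof. by move=> [s [A B]]; exists s. Qed.

Lemma gram_extension (X : Type) (f f' : X -> E) : spanning f -> spanning f' ->
  (forall x y, ip (f x) (f y) = ip (f' x) (f' y)) ->
  exists U : E -> E, [/\ bijective U, forall x y, ip (U x) (U y) = ip x y
    & forall x, U (f x) = f' x].
Proof.
move=> tf tf' gram; have gram' x y : ip (f' x) (f' y) =
  ip (f x) (f y) by rewrite gram.
have [U UP] := choice (fun z => gram_rel_total gram z tf).
have [W WP] := choice (fun z => gram_rel_total gram' z tf').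
exists U; split.
- exists W => z.
    by apply/(gram_rel_inj gram' (WP (U z)) (gram_relC (UP z))).
  by apply/(gram_rel_inj gram (UP (W z)) (gram_relC (WP z))).
- by move=> x y; apply: gram_rel_ip (UP x) (UP y).
- by move=> x; apply/(gram_rel_inj gram (UP (f x)) (gram_rel_base f f' x)).
Qed.

(** * Orthonormal bases *)

Fixpoint gram_schmidt_seq (d : nat -> E) (n : nat) : seq E :=
  if n is n'.+1 then
    let l := gram_schmidt_seq d n' in
    let g := d n' - \sum_(e <- l) ip (d n') e *: e in
    rcons l (`|g|^-1 *: g)
  else [::].

(* Normalization sends a vanishing difference to 0 since 0^-1 = 0. *)
Definition gram_schmidt (d : nat -> E) (n : nat) : E :=
  let g := d n - \sum_(e <- gram_schmidt_seq d n) ip (d n) e *: e in `|g|^-1 *: g.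

Lemma gram_schmidtE (d : nat -> E) n :
  let g := d n - \sum_(i < n) ip (d n) (gram_schmidt d i) *: gram_schmidt d i in
  gram_schmidt d n = `|g|^-1 *: g.
Proof.
have EQ : gram_schmidt_seq d n = [seq gram_schmidt d i | i <- index_iota 0 n].
  rewrite /index_iota subn0; elim: n => // n IH.
  by rewrite -addn1 iotaD map_cat -IH addn1 /= cats1 add0n.
by rewrite /= {1}/gram_schmidt EQ big_map big_mkord.
Qed.

Lemma gram_schmidt_norm d n : gram_schmidt d n = 0 \/
  ip (gram_schmidt d n) (gram_schmidt d n) = 1.
Proof.
rewrite gram_schmidtE; set g := _ - _.
have [->|g0] := eqVneq g 0; [by left; rewrite scaler0|right].
by rewrite ipZl ipZr ipxx mulrA -expr2 exprVn mulVf // sqrf_eq0 normr_eq0.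
Qed.

Lemma gram_schmidt_orth d i j : i != j ->
  ip (gram_schmidt d i) (gram_schmidt d j) = 0.
Proof.
wlog lt_ji : i j / (j < i)%N => [W|].
  by case: (ltngtP i j) => // ij _; [rewrite ipC|]; apply: W; rewrite // gtn_eqF.
move=> _; elim/ltn_ind: i j lt_ji => n IH j ltjn.
have key : ip (\sum_(i < n) ip (d n) (gram_schmidt d i) *: gram_schmidt d i)
    (gram_schmidt d j) =
    ip (d n) (gram_schmidt d j) * ip (gram_schmidt d j) (gram_schmidt d j).
  rewrite ip_suml (bigD1 (Ordinal ltjn)) //= ipZl big1 ?addr0 // => -[i ltin] /=.
  rewrite -val_eqE /= ipZl => ij.
  case: (ltngtP i j) ij => // [ij|ji] _; last by rewrite IH ?mulr0.
  by rewrite (ipC (gram_schmidt d i) (gram_schmidt d j)) IH ?mulr0.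
rewrite gram_schmidtE ipZl ipDl ipNl key.
case: (gram_schmidt_norm d j) => [->|->]; first by rewrite !ip0r mul0r subr0 mulr0.
by rewrite mulr1 subrr mulr0.
Qed.

Lemma gram_schmidt_span d n : exists s, d n = comb (gram_schmidt d) s.
Proof.
have := gram_schmidtE d n; set S := \sum_(i < n) _; move=> /= EQ.
exists ((`|d n - S|, n) :: [seq (ip (d n) (gram_schmidt d i),
  i) | i <- index_iota 0 n]).
rewrite /comb big_cons /= big_map big_mkord EQ -/S.
rewrite scalerA; have [g0|g0] := eqVneq (d n - S) 0.
  by rewrite g0 scaler0 add0r; apply/eqP; rewrite -subr_eq0 g0.
by rewrite mulfV ?normr_eq0 // scale1r subrK.
Qed.

Lemma dense_spanning (D : set E) (d : nat -> E) : dense D ->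
  D `<=` range d -> spanning d.
Proof.
move=> dD Dd z e e0.
have [|y [Hy /Dd[n _ dn]]] := dD (ball z e) _ (ball_open z e).
  by exists z; apply: ballxx.
exists [:: (1, n)]; rewrite comb1 dn.
by move: Hy; rewrite -ball_normE.
Qed.

(** The index type is left free so that basis vectors can be attached to the vertices of the
    tree. *)
Lemma orthonormal_basis (T : countType) : infinite_set [set: T] ->
  separable E -> infinite_dimensional E ->
  exists2 b : T -> E, forall s t, ip (b s) (b t) = (s == t)%:R & spanning b.
Proof.
move=> Tinf [D cD dD] Einf.
have [d Dd] : exists d : nat -> E, D `<=` range d.
  have [g gP] := countable_injP _ cD.
  pose d n := get [set x | D x /\ g x = n].
  exists d => x Dx; exists (g x) => //.
  have /getPex[] : [set y | D y /\ g y = g x] !=set0 by exists x.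
  by rewrite -/(d (g x)) => Dy; apply: gP; rewrite ?inE.
have td := dense_spanning dD Dd.
pose ev := gram_schmidt d; have tev : spanning ev :=
  spanning_trans td (gram_schmidt_span d).
pose I := [set n | ev n <> 0].
have Iinf : infinite_set I.
  (* If only finitely many vectors were nonzero, each [x] would equal its finite Fourier sum, since
     the difference is orthogonal to a spanning family. *)
  move=> /finite_seqP[s sI]; apply: Einf.
  pose l := undup s; exists (size l), (fun k => ev (tnth (in_tuple l) k)) => x.
  exists (fun k => ip x (ev (tnth (in_tuple l) k))).
  rewrite -(big_tnth _ _ l xpredT (fun i => ip x (ev i) *: ev i)).
  apply/eqP; rewrite -subr_eq0; apply/eqP/(spanning_orth tev) => j.
  rewrite ipDl ipNl ip_suml; have [->|/eqP ej] := eqVneq (ev j) 0.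
    by rewrite ip0r big1 ?subr0 // => i _; rewrite ip0r.
  have jl : j \in l by rewrite mem_undup; have : I j by []; rewrite sI.
  rewrite (bigD1_seq j) ?undup_uniq //= ipZl big1 ?addr0.
    by case: (gram_schmidt_norm d j) => // ->; rewrite mulr1 subrr.
  by move=> i ij; rewrite ipZl gram_schmidt_orth ?mulr0.
have natI : (I #= [set: nat])%card.
  by rewrite card_eqPle; split; [exact: countableP|exact/infiniteP].
have natT : ([set: T] #= [set: nat])%card.
  by rewrite card_eqPle; split; [exact: countableP|exact/infiniteP].
have : ([set: T] #= I)%card by apply: card_eq_trans natT _; rewrite card_eq_sym.
move/card_set_bijP => [h [hI hinj hsurj]].
exists (ev \o h) => [s t|] /=.
  have [<-|st] := eqVneq s t.
    by case: (gram_schmidt_norm d (h s)) => // e0; case: (hI s).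
  rewrite gram_schmidt_orth //; apply: contra_neq st => st.
  by apply: hinj; rewrite ?inE.
apply: spanning_trans tev _ => n; have [->|/eqP en] := eqVneq (ev n) 0.
  by exists [::]; rewrite /comb big_nil.
have [t _ <-] := hsurj n en; exists [:: (1, t)].
by rewrite comb1.
Qed.
(** * The projective model *)

(** Proves an equality modulo the relation [p = q]: once the cofactor [c] is supplied, the remaining
    goal is a polynomial identity within reach of [lra]. *)
Lemma eq_lincomb (a b c p q : R) : p = q -> a - b = c * (p - q) -> a = b.
Proof. by move=> ->; rewrite subrr mulr0 => /eqP; rewrite subr_eq0 => /eqP. Qed.

Definition ch (t : R) : R := (expR t + expR (- t)) / 2.

Lemma acosh_arg_ge1 (t : R) : 1 <= t -> 1 <= t + Num.sqrt (t ^+ 2 - 1).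
Proof. by move=> t1; rewrite -[1]addr0 lerD // sqrtr_ge0. Qed.

Lemma ch_acosh (t : R) : 1 <= t -> ch (acosh t) = t.
Proof.
move=> t1; have H1 := acosh_arg_ge1 t1; have H0 := lt_le_trans ltr01 H1.
have sq : Num.sqrt (t ^+ 2 - 1) ^+ 2 = t ^+ 2 - 1.
  by rewrite sqr_sqrtr // subr_ge0 expr_ge1 // (le_trans ler01).
rewrite /ch expRN /acosh lnK ?posrE //.
set u := Num.sqrt _ in sq H0 H1 *; have -> : (t + u)^-1 = t - u.
  by apply: (mulfI (lt0r_neq0 H0)); rewrite mulfV ?lt0r_neq0 //; lra.
by lra.
Qed.

Lemma acosh_lt (t u : R) : 1 <= t -> t < u -> acosh t < acosh u.
Proof.
move=> t1 tu; have u1 := le_trans t1 (ltW tu).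
have H (t' : R) : 1 <= t' -> 0 < t' + Num.sqrt (t' ^+ 2 - 1).
  by move=> /acosh_arg_ge1; apply: lt_le_trans.
rewrite /acosh ltr_ln ?posrE ?H //; apply: ltr_leD => //.
by rewrite ler_wsqrtr // lerD2r ler_pXn2r // ?nnegrE ?ltW //; lra.
Qed.

Lemma acosh_ge0 (t : R) : 1 <= t -> 0 <= acosh t.
Proof. by move=> /acosh_arg_ge1; exact: ln_ge0. Qed.

Lemma acosh_ch (t : R) : acosh (ch t) = `|t|.
Proof.
wlog t0 : t / 0 <= t.
  move=> W; case: (leP 0 t) => [/W //|t0].
  have -> : ch t = ch (- t) by rewrite /ch opprK addrC.
  by rewrite W ?normrN // oppr_ge0 ltW.
have eK : expR t * expR (- t) = 1 by rewrite -expRD subrr expR0.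
have le_e : expR (- t) <= expR t by rewrite ler_expR; lra.
rewrite /acosh ger0_norm //.
have -> : ch t ^+ 2 - 1 = ((expR t - expR (- t)) / 2) ^+ 2.
  by apply: (eq_lincomb (c := 1) eK); rewrite /ch; lra.
rewrite sqrtr_sqr ger0_norm; last by lra.
by rewrite -[RHS]expRK; congr ln; rewrite /ch; lra.
Qed.

Lemma hball_ip_lt1 (x : hball E) : ip (set_val x) (set_val x) < 1.
Proof.
have := set_valP x; rewrite /hball /= ipxx => x1.
by rewrite expr_lt1.
Qed.

Lemma hball_inj (x y : hball E) : set_val x = set_val y -> x = y.
Proof. exact: val_inj. Qed.

Definition mkhball (x : E) (x1 : ip x x < 1) : hball E.
Proof.
exists x; rewrite inE /hball /=; move: x1; rewrite ipxx.
by apply: contraTT; rewrite -!leNgt => x1; rewrite expr_ge1.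
Defined.

Lemma set_val_mkhball x (x1 : ip x x < 1) : set_val (mkhball x1) = x.
Proof. by []. Qed.

(** The inverse Lorentz factor: the lift of [x] to the hyperboloid is (1, x) divided by
    [dgamma x]. *)
Definition dgamma (x : E) : R := Num.sqrt (1 - `|x| ^+ 2).

Definition hratio (x y : E) : R := (1 - ip x y) / (dgamma x * dgamma y).

Lemma dgamma_sqr x : ip x x < 1 -> dgamma x ^+ 2 = 1 - ip x x.
Proof. by move=> x1; rewrite /dgamma sqr_sqrtr -ipxx // subr_ge0 ltW. Qed.

Lemma dgamma_gt0 x : ip x x < 1 -> 0 < dgamma x.
Proof. by move=> x1; rewrite /dgamma sqrtr_gt0 -ipxx subr_gt0. Qed.

Lemma dgamma_le1 x : dgamma x <= 1.
Proof.
rewrite -[leRHS]sqrtr1 /dgamma ler_wsqrtr //; have := sqr_ge0 `|x|; lra.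
Qed.

Lemma dgamma0 : dgamma 0 = 1.
Proof. by rewrite /dgamma normr0 expr0n subr0 sqrtr1. Qed.

Lemma ip_lt1 x y : ip x x < 1 -> ip y y <= 1 -> ip x y < 1.
Proof.
move=> x1 y1; have := ip_sqr_le x y; have := ip_ge0 y; have := ip_ge0 x => *.
rewrite ltNge; apply/negP => xy; nra.
Qed.

(** The reversed Cauchy-Schwarz inequality for timelike vectors: the difference of the squares is (1
    - |x|^2) |x - y|^2 + ip x (x - y)^2. *)
Lemma hratio_ge1 x y : ip x x < 1 -> ip y y < 1 -> 1 <= hratio x y.
Proof.
move=> x1 y1; have sx := dgamma_gt0 x1; have sy := dgamma_gt0 y1.
have B0 : 0 < 1 - ip x y by rewrite subr_gt0 ip_lt1 // ltW.
rewrite /hratio ler_pdivlMr ?mulr_gt0 // mul1r.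
rewrite -(@ler_pXn2r _ 2) ?nnegrE ?mulr_ge0 ?(ltW sx) ?(ltW sy) ?(ltW B0) //.
rewrite exprMn !dgamma_sqr //.
have D0 := ip_ge0 (x - y); rewrite ip_subxx in D0.
have P0 : 0 <= (1 - ip x x) * (ip x x - 2 * ip x y + ip y y).
  by rewrite mulr_ge0 // subr_ge0 ltW.
by have := sqr_ge0 (ip x x - ip x y); lra.
Qed.

Lemma hdistE (x y : hball E) : hdist ip x y =
  acosh (hratio (set_val x) (set_val y)).
Proof. by []. Qed.

Lemma ch_hdist (x y : hball E) : ch (hdist ip x y) = hratio (set_val x) (set_val y).
Proof. by rewrite ch_acosh // hratio_ge1 // hball_ip_lt1. Qed.

Lemma hdist_inj (x y x' y' : hball E) : hdist ip x y = hdist ip x' y' <->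
  hratio (set_val x) (set_val y) = hratio (set_val x') (set_val y').
Proof. by split=> EQ; [rewrite -!ch_hdist EQ|rewrite !hdistE EQ]. Qed.

(** A projective transformation is a Lorentz map followed by rescaling of the lifts; the scalars [c]
    and [d] cancel in the ratio. *)
Lemma hratio_conformal (x y x' y' : E) (c d : R) : 0 < c -> 0 < d ->
  ip x x < 1 -> ip y y < 1 ->
  1 - ip x' x' = (1 - ip x x) * c ^+ 2 -> 1 - ip y' y' = (1 - ip y y) * d ^+ 2 ->
  1 - ip x' y' = (1 - ip x y) * (c * d) -> hratio x' y' = hratio x y.
Proof.
move=> c0 d0 x1 y1 xx yy xy; rewrite /hratio xy.
have dg z z' (e : R) : 0 < e -> ip z z < 1 -> 1 - ip z' z' =
  (1 - ip z z) * e ^+ 2 ->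
    dgamma z' = dgamma z * e.
  move=> e0 z1 zz; rewrite /dgamma -!ipxx zz sqrtrM ?sqrtr_sqr ?gtr0_norm //.
  by rewrite subr_ge0 ltW.
rewrite (dg _ _ _ c0 x1 xx) (dg _ _ _ d0 y1 yy) mulrACA -mulf_div divff ?mulr1 //.
by rewrite mulf_neq0 // lt0r_neq0.
Qed.

(** The distance to the origin determines [dgamma x]; the other distances then determine the inner
    products with a spanning family. *)
Lemma hdist_separates (X : Type) (p : X -> hball E) (o : X) (x y : hball E) :
  spanning (set_val \o p) -> p o = origin E ->
  (forall v, hdist ip x (p v) = hdist ip y (p v)) -> x = y.
Proof.
move=> tp po xy; have rxy v : hratio (set_val x) (set_val (p v)) =
  hratio (set_val y) (set_val (p v)).
  exact/hdist_inj.
have sx := dgamma_gt0 (hball_ip_lt1 x); have sy := dgamma_gt0 (hball_ip_lt1 y).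
have sxy : dgamma (set_val x) = dgamma (set_val y).
  have := rxy o; rewrite po /hratio /= ip0r ip0r dgamma0 !mulr1 subr0 !div1r.
  exact: invr_inj.
apply/hball_inj/(spanning_eq tp) => v /=.
have := rxy v; rewrite /hratio sxy => /divIf H.
have sv := dgamma_gt0 (hball_ip_lt1 (p v)).
have /H : dgamma (set_val y) * dgamma (set_val (p v)) != 0 by rewrite mulf_neq0
  ?lt0r_neq0.
by move=> {}H; lra.
Qed.

(** The Lorentz reflection that exchanges the lifts of [q] and of the origin. It moves a vector only
    along the difference of these lifts, whence the last clause, which later shows that the
    reflected vertices still span. *)
Lemma hball_reflection (q : hball E) : exists t : hball E -> hball E,
  [/\ involutive t, forall x y, hdist ip (t x) (t y) = hdist ip x y,
      t q = origin E, t (origin E) = q &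
      forall x, exists a b : R,
        set_val x = a *: set_val (t x) + b *: set_val q].
Proof.
have [q0|q0] := eqVneq (set_val q) 0.
  have -> : q = origin E by exact: hball_inj.
  exists id; split => // x; exists 1, 0.
  by rewrite scale1r scale0r addr0.
pose s := dgamma (set_val q).
have q1 := hball_ip_lt1 q; have s0 : 0 < s := dgamma_gt0 q1.
have sq : s ^+ 2 = 1 - ip (set_val q) (set_val q) := dgamma_sqr q1.
have qq0 : 0 < ip (set_val q) (set_val q).
  by rewrite lt_def ip_ge0 andbT; apply: contra_neq q0 => /ip_eq0.
have s1 : s < 1 by rewrite ltNge; apply/negP => s1; nra.
pose i := (1 - s)^-1; have iE : (1 - s) * i = 1 by rewrite mulfV // subr_eq0 gt_eqF.
pose a x := ip x (set_val q).
have a1 x : ip x x < 1 -> 0 < 1 - a x.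
  by move=> x1; rewrite subr_gt0 ip_lt1 // ltW.
(* The reflection in the hyperplane orthogonal to (1, 0) - (1, q) / s, applied to (1, x) and divided
   by its time coordinate (1 - a x) / s. *)
pose f x : E := (1 - a x)^-1 *: (s *: x + (1 - a x * i) *: set_val q).
have fB x y : ip x x < 1 -> ip y y < 1 ->
    1 - ip (f x) (f y) = (1 - ip x y) * ((s / (1 - a x)) * (s / (1 - a y))).
  move=> x1 y1; have ax := a1 x x1; have ay := a1 y y1.
  rewrite /f !ipE -/(a x) (ipC (set_val q) y) -/(a y).
  have qqE : ip (set_val q) (set_val q) = 1 - s ^+ 2 by lra.
  rewrite qqE.
  set X := (1 - a x)^-1; set Y := (1 - a y)^-1.
  have XE : (1 - a x) * X = 1 by rewrite mulfV // lt0r_neq0.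
  have YE : (1 - a y) * Y = 1 by rewrite mulfV // lt0r_neq0.
  set A := a x in XE *; set B := a y in YE *; set C := ip x y.
  have H : (1 - A) * (1 - B) - (s * (s * C + (1 - B * i) * A) +
    (1 - A * i) * (s * B + (1 - B * i) * (1 - s ^+ 2))) = s ^+ 2 * (1 - C).
    apply: (eq_lincomb (c := - ( - A - B - s * (A + B) + A * B + A * B * i * (1 +
      s))) iE); lra.
  have -> : (1 - C) * (s * X * (s * Y)) = X * Y * (s ^+ 2 * (1 - C)) by lra.
  rewrite -H.
  have XY : (1 - A) * X * ((1 - B) * Y) = 1 by rewrite XE YE mulr1.
  by apply: (eq_lincomb (c := -1) XY); lra.
have c0 x : ip x x < 1 -> 0 < s / (1 - a x) by move=> x1; rewrite divr_gt0 ?a1.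
have f1 x : ip x x < 1 -> ip (f x) (f x) < 1.
  move=> x1; rewrite -subr_gt0 fB //; have := c0 x x1 => cx.
  by apply: mulr_gt0; [rewrite subr_gt0|exact: mulr_gt0].
have af x : ip x x < 1 -> 1 - a (f x) = s ^+ 2 / (1 - a x).
  move=> x1; have ax := a1 x x1; rewrite /f {1}/a !ipE -/(a x).
  have qqE : ip (set_val q) (set_val q) = 1 - s ^+ 2 by lra.
  rewrite qqE.
  apply: (mulfI (lt0r_neq0 ax));
    rewrite mulrBr mulr1 mulrA mulfV ?lt0r_neq0 // mul1r.
  rewrite [RHS]mulrCA mulfV ?lt0r_neq0 // mulr1.
  by apply: (eq_lincomb (c := a x * (1 + s)) iE); lra.
have ff x : ip x x < 1 -> f (f x) = x.
  move=> x1; have ax := a1 x x1; have axN := lt0r_neq0 ax.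
  rewrite {1}/f af // /f scalerDr !scalerA.
  have s2N : s ^+ 2 != 0 by rewrite expf_neq0 // lt0r_neq0.
  rewrite invfM invrK scalerDr !scalerA -addrA -scalerDl.
  have V1 : s ^+ 2 * s ^- 2 = 1 by rewrite mulfV.
  have V2 : (1 - a x) * (1 - a x)^-1 = 1 by rewrite mulfV.
  transitivity (1 *: x + 0 *: set_val q); last by rewrite scale1r scale0r addr0.
  congr (_ *: _ + _ *: _).
    set S' := s ^- 2 in V1 *; set X := (1 - a x)^-1 in V2 *.
    transitivity ((s ^+ 2 * S') * ((1 - a x) * X)); first by lra.
    by rewrite V1 V2 mulr1.
  have -> : a ((1 - a x)^-1 *: (s *: x + (1 - a x * i) *: set_val q)) =
      1 - s ^+ 2 / (1 - a x) by have := af x x1; rewrite /f; lra.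
  set S' := s ^- 2; set X := (1 - a x)^-1 in V2 *.
  have H : s * (1 - a x * i) + (1 - a x - (1 - a x - s ^+ 2) * i) = 0.
    by apply: (eq_lincomb (c := - (1 + s - a x)) iE); lra.
  transitivity (S' * (s * (1 - a x * i) + (1 - a x - (1 - a x - s ^+ 2) * i))).
    apply: (eq_lincomb (c := S' * (s * (1 - a x * i) + s ^+ 2 * i)) V2); lra.
  by rewrite H mulr0.
pose t x := mkhball (f1 _ (hball_ip_lt1 x)).
exists t; split.
- by move=> x; apply: hball_inj; rewrite !set_val_mkhball ff // hball_ip_lt1.
- move=> x y; apply/hdist_inj; rewrite !set_val_mkhball.
  have x1 := hball_ip_lt1 x; have y1 := hball_ip_lt1 y.
  by apply: (hratio_conformal (c0 _ x1) (c0 _ y1)) => //; rewrite fB // ?expr2.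
- apply: hball_inj; rewrite set_val_mkhball /f -scalerDl.
  have -> : s + (1 - a (set_val q) * i) = 0; last by rewrite scale0r scaler0.
  have -> : a (set_val q) = 1 - s ^+ 2 by rewrite /a; lra.
  by apply: (eq_lincomb (c := - (1 + s)) iE); lra.
- apply: hball_inj; rewrite set_val_mkhball /f /= /a ip0l.
  by rewrite mul0r subr0 invr1 !scale1r scaler0 add0r.
- move=> x; have x1 := hball_ip_lt1 x; have ax := a1 _ x1.
  exists (s^-1 * (1 - a (set_val x))), (- (s^-1 * (1 - a (set_val x) * i))).
  rewrite set_val_mkhball /f scalerA -mulrA mulfV ?lt0r_neq0 // mulr1 scalerDr
    !scalerA.
  by rewrite mulVf ?lt0r_neq0 // scale1r scaleNr addrK.
Qed.

(** The reflection [t] brings the image of [o] back to the origin. Distances to the origin then give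
    the norms and the remaining distances the inner products, so a linear isometry [U] does the
    rest, and [t] is undone. *)
Lemma isometry_extension (X : Type) (p : X -> hball E) (o : X) (f : X -> X) :
  spanning (set_val \o p) -> p o = origin E -> bijective f ->
  (forall v w, hdist ip (p (f v)) (p (f w)) = hdist ip (p v) (p w)) ->
  exists2 g, Isom ip g & forall v, g (p v) = p (f v).
Proof.
move=> sp po [f' fK f'K] pf.
have [t [tK td tq to tlin]] := hball_reflection (p (f o)).
pose F v := set_val (t (p (f v))).
have Fo : F o = 0 by rewrite /F tq.
have rF v w : hratio (F v) (F w) = hratio (set_val (p v)) (set_val (p w)).
  by apply/hdist_inj; rewrite td pf.
have po0 : set_val (p o) = 0 by rewrite po.
have dF v : dgamma (F v) = dgamma (set_val (p v)).
  have := rF v o; rewrite /hratio Fo po0 !ip0r dgamma0 !mulr1 subr0 !div1r.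
  exact: invr_inj.
have FF v w : ip (set_val (p v)) (set_val (p w)) = ip (F v) (F w).
  have := rF v w; rewrite /hratio !dF => /divIf H.
  have dv := dgamma_gt0 (hball_ip_lt1 (p v)); have dw :=
    dgamma_gt0 (hball_ip_lt1 (p w)).
  have /H : dgamma (set_val (p v)) * dgamma (set_val (p w)) != 0.
    by rewrite mulf_neq0 ?lt0r_neq0.
  by move=> {}H; lra.
(* By the last clause of [hball_reflection], [p w] is a combination of t (p w) = F (f' w) and p (f
   o) = F (f' o). *)
have sF : spanning F.
  apply: spanning_trans sp _ => w /=.
  have [a [b ->]] := tlin (p w).
  exists [:: (a, f' w); (b, f' o)].
  by rewrite /comb big_cons big_seq1 /= /F !f'K po to.
have [U [Ub UU Up]] := gram_extension sp sF FF.
have U1 (x : hball E) : ip (U (set_val x)) (U (set_val x)) < 1.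
  by rewrite UU hball_ip_lt1.
pose u x := mkhball (U1 x).
have [U' UK U'K] := Ub.
have U1' (x : hball E) : ip (U' (set_val x)) (U' (set_val x)) < 1.
  by rewrite -UU U'K hball_ip_lt1.
pose u' x := mkhball (U1' x).
exists (t \o u); last first.
  move=> v /=; have -> : u (p v) = t (p (f v)) by apply: hball_inj; exact: Up.
  exact: tK.
split=> [|x y /=].
  exists (u' \o t) => x /=.
    by rewrite tK; apply: hball_inj; exact: UK.
  by rewrite -[RHS]tK; congr t; apply: hball_inj; exact: U'K.
by rewrite td; apply/hdist_inj; rewrite /= /hratio /dgamma -!ipxx !UU.
Qed.

(** * Half-spaces and geodesics *)

Lemma cvg_hball (u : nat -> hball E) (z : hball E) :
  set_val (u n) @[n --> \oo] --> set_val z -> u n @[n --> \oo] --> z.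
Proof.
move=> uz A /= [_ [[B Bop <-] Bz BA]].
have /uz : nbhs (set_val z) B by apply: open_nbhs_nbhs.
move=> uB; suff : \forall n \near \oo, A (u n) by [].
have {}uB : \forall n \near \oo, B (set_val (u n)) by [].
by apply: filterS uB => n; exact: BA.
Qed.

Lemma closed_hball_lim (S : set (hball E)) (u : nat -> hball E) (z : hball E) :
  closed S -> (\forall n \near \oo, S (u n)) ->
  set_val (u n) @[n --> \oo] --> set_val z -> S z.
Proof. by move=> cS Su /cvg_hball; exact: closed_cvg. Qed.

Lemma ip_continuous (w : E) : continuous (ip^~ w : E -> R).
Proof.
move=> x; apply/cvgrPdist_lt => e e0.
have W0 : 0 < `|w| + 1 by rewrite ltr_wpDl.
have /cvgrPdist_lt /(_ (e / (`|w| + 1))) : id y @[y --> x] --> x by exact: cvg_id.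
rewrite divr_gt0 // => /(_ isT); apply: filterS => y /= xy.
have -> : ip x w - ip y w = ip (x - y) w by rewrite !ipE.
apply: le_lt_trans (ip_norm_le _ _) _.
move: xy; rewrite ltr_pdivlMr // => xy; apply: le_lt_trans xy.
by rewrite ler_wpM2l // lerDl.
Qed.

Definition half_space (w : E) (t : R) : set (hball E) :=
  [set y | ip (set_val y) w <= t].

Lemma closed_half_space w t : closed (half_space w t).
Proof.
have c : continuous (fun y : hball E => ip (set_val y) w : R).
  move=> y; apply: (@continuous_comp _ _ _ (set_val : hball E -> E) (ip^~ w)).
    exact: initial_continuous.
  exact: ip_continuous.
have -> : half_space w t = (fun y : hball E =>
  ip (set_val y) w) @^-1` [set r | r <= t] by [].
by apply: closed_comp => [y _|]; [exact: c|exact: closed_le].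
Qed.

(* Three points on a geodesic have linearly dependent lifts to the hyperboloid,
   with the coefficients of sinh(l) z = sinh(l - s) x + sinh(s) y. *)
Lemma geodesic_lincomb (x y z : hball E) (s r : R) : 0 <= s -> 0 <= r ->
  0 < s + r ->
  hdist ip x z = s -> hdist ip z y = r -> hdist ip x y = s + r ->
  exists a b c : R, [/\ 0 <= a, 0 <= b, 0 < c, c = a + b &
    c *: set_val z = a *: set_val x + b *: set_val y].
Proof.
move=> s0 r0 sr0 xz zy xy.
have x1 := hball_ip_lt1 x; have y1 := hball_ip_lt1 y; have z1 := hball_ip_lt1 z.
have dx := dgamma_gt0 x1; have dy := dgamma_gt0 y1; have dz := dgamma_gt0 z1.
have Sx := dgamma_sqr x1; have Sy := dgamma_sqr y1; have Sz := dgamma_sqr z1.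
have Bd (u v : hball E) d : hdist ip u v = d ->
    1 - ip (set_val u) (set_val v) =
      ch d * (dgamma (set_val u) * dgamma (set_val v)).
  move=> <-; rewrite ch_hdist /hratio mulfVK // mulf_neq0 // lt0r_neq0 //
    dgamma_gt0 // hball_ip_lt1 //.
have := Bd _ _ _ xz; have := Bd _ _ _ zy; have := Bd _ _ _ xy.
rewrite /ch opprD !expRD.
have ss : expR s * expR (- s) = 1 by rewrite -expRD subrr expR0.
have rr : expR r * expR (- r) = 1 by rewrite -expRD subrr expR0.
have es : 1 <= expR s by rewrite -expR0 ler_expR.
have er : 1 <= expR r by rewrite -expR0 ler_expR.
have esr : 1 < expR s * expR r by rewrite -expRD -expR0 ltr_expR.
set e := expR s in ss es esr *; set e' := expR (- s) in ss *.
set f := expR r in rr er esr *; set f' := expR (- r) in rr *.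
have e'1 : e' <= 1 by rewrite /e' -expR0 ler_expR; lra.
have f'1 : f' <= 1 by rewrite /f' -expR0 ler_expR; lra.
have ef'1 : e' * f' < 1 by rewrite /e' /f' -expRD -expR0 ltr_expR; lra.
set X := set_val x in x1 dx Sx *; set Y := set_val y in y1 dy Sy *.
set Z := set_val z in z1 dz Sz *.
set p := dgamma X in dx Sx *; set q := dgamma Y in dy Sy *; set k :=
  dgamma Z in dz Sz *.
move=> Bxy Bzy Bxz.
have pp : p * p^-1 = 1 by rewrite mulfV // lt0r_neq0.
have qq : q * q^-1 = 1 by rewrite mulfV // lt0r_neq0.
have kk : k * k^-1 = 1 by rewrite mulfV // lt0r_neq0.
have p'0 : 0 < p^-1 by rewrite invr_gt0.
have q'0 : 0 < q^-1 by rewrite invr_gt0.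
have k'0 : 0 < k^-1 by rewrite invr_gt0.
(* Twice sinh r, sinh s and sinh (s + r), divided by the factors [dgamma] that normalize the
   lifts. *)
pose a := (f - f') * p^-1; pose b := (e - e') * q^-1; pose c :=
  (e * f - e' * f') * k^-1.
have a0 : 0 <= a by rewrite mulr_ge0 ?(ltW p'0) //; lra.
have b0 : 0 <= b by rewrite mulr_ge0 ?(ltW q'0) //; lra.
have c0 : 0 < c by rewrite mulr_gt0 //; lra.
(* The vector (w0, w) turns out to be Lorentz orthogonal to the lifts of the three points, hence to
   itself. An isotropic vector orthogonal to the timelike (1, Z) vanishes. *)
pose w := c *: Z - a *: X - b *: Y; pose w0 := c - a - b.
have wE u : ip w u = c * ip Z u - a * ip X u - b * ip Y u by rewrite /w !ipE.
have wE' u : ip u w = c * ip u Z - a * ip u X - b * ip u Y by rewrite /w !ipE.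
have cZ v m : c * (m * (k * v)) = (e * f - e' * f') * m * v.
  by apply: (eq_lincomb (c := (e * f - e' * f') * m * v) kk); rewrite /c; lra.
have aX v m : a * (m * (p * v)) = (f - f') * m * v.
  by apply: (eq_lincomb (c := (f - f') * m * v) pp); rewrite /a; lra.
have bY v m : b * (m * (q * v)) = (e - e') * m * v.
  by apply: (eq_lincomb (c := (e - e') * m * v) qq); rewrite /b; lra.
have wS u : w0 - ip w u = c * (1 - ip Z u) - a * (1 - ip X u) - b * (1 - ip Y u).
  by rewrite wE /w0; lra.
have wZ : w0 - ip w Z = 0.
  have -> : w0 - ip w Z = c * (1 * (k * k)) - a * ((e +
    e') / 2 * (p * k)) - b * ((f + f') / 2 * (q * k)).
    by rewrite wS -Bxz (ipC Y Z) (mulrC q k) -Bzy mul1r -expr2 Sz.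
  by rewrite cZ aX bY; lra.
have wX : w0 - ip w X = 0.
  have -> : w0 - ip w X = c * ((e +
    e') / 2 * (k * p)) - a * (1 * (p * p)) - b * ((e * f + e' * f') / 2 * (q * p)).
    by rewrite wS (ipC Z X) (ipC Y X) (mulrC k p) -Bxz (mulrC q p) -Bxy mul1r
      -expr2 Sx.
  by rewrite cZ aX bY; apply: (eq_lincomb (c := (f - f') * p) ss); lra.
have wY : w0 - ip w Y = 0.
  have -> : w0 - ip w Y = c * ((f + f') / 2 * (k * q)) - a * ((e * f +
    e' * f') / 2 * (p * q)) - b * (1 * (q * q)).
    by rewrite wS -Bxy -Bzy mul1r -expr2 Sy.
  by rewrite cZ aX bY; apply: (eq_lincomb (c := (e - e') * q) rr); lra.
have ww : ip w w = w0 ^+ 2.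
  rewrite wE'.
  have -> : ip w Z = w0 by lra.
  have -> : ip w X = w0 by lra.
  have -> : ip w Y = w0 by lra.
  by rewrite /w0; lra.
have w00 : ip w w = 0.
  have := ip_sqr_le w Z; have -> : ip w Z = w0 by lra.
  have := ip_ge0 w; rewrite -ww => w_ge0 H; apply/eqP; rewrite eq_le w_ge0 andbT.
  have z0 : 0 < 1 - ip Z Z by rewrite subr_gt0.
  by rewrite -(pmulr_lle0 _ z0); lra.
exists a, b, c; split => //.
  by move: ww; rewrite w00 => /esym/eqP; rewrite sqrf_eq0 => /eqP; rewrite /w0; lra.
by move: (ip_eq0 w00) => /eqP; rewrite /w -addrA -opprD subr_eq0 => /eqP.
Qed.

Lemma hconvex_half_space w t : hconvex ip (half_space w t).
Proof.
move=> x y xt yt z [gamma [l [geo g0 gl [s /andP[s0 sl] ->]]]].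
have l0 : 0 <= l := le_trans s0 sl.
have [l00|lN] := eqVneq l 0.
  have -> : s = 0 by apply/eqP; rewrite eq_le s0 andbT -l00.
  by rewrite g0.
have I0 : `[0, l]%classic 0 by rewrite /= in_itv /= lexx.
have Il : `[0, l]%classic l by rewrite /= in_itv /= lexx l0.
have Is : `[0, l]%classic s by rewrite /= in_itv /= s0 sl.
have [||||||a [b [c [a0 b0 c0 cE zE]]]] :=
  @geodesic_lincomb x y (gamma s) s (l - s).
- by [].
- by rewrite subr_ge0.
- by rewrite addrC subrK lt_def lN.
- by rewrite -g0 geo // sub0r normrN ger0_norm.
- by rewrite -gl geo // distrC ger0_norm // subr_ge0.
- by rewrite -g0 -gl geo // sub0r normrN ger0_norm // addrC subrK.
move: xt yt; rewrite /half_space /= => xt yt.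
have H : c * ip (set_val (gamma s)) w = a * ip (set_val x) w + b * ip (set_val y) w.
  by rewrite -ipZl //; rewrite zE !ipE.
by rewrite -(ler_pM2l c0) H cE; nra.
Qed.

(** The curve e^t (1, xi) + e^(-t) (1, eta) in the plane of two isotropic vectors is, up to a
    constant factor, a unit-speed geodesic of the hyperboloid; [f] is its projection to the ball. *)
Lemma chord_geodesic (xi eta : E) : ip xi xi = 1 -> ip eta eta = 1 -> xi != eta ->
  exists2 gamma : R -> hball E, geodesic_on ip setT gamma &
    forall th, 0 < th -> th < 1 -> exists t,
      set_val (gamma t) = th *: xi + (1 - th) *: eta.
Proof.
move=> x1 y1 xy; set k := ip xi eta.
have k1 : 0 < 1 - k.
  have : 0 < ip (xi - eta) (xi - eta).
    by rewrite lt_def ip_ge0 andbT; apply: contra_neq xy => /ip_eq0/eqP;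
      rewrite subr_eq0 => /eqP.
  by rewrite ip_subxx x1 y1 -/k; lra.
pose m (t : R) := (expR t + expR (- t))^-1.
have eK (t : R) : expR t * expR (- t) = 1 by rewrite -expRD subrr expR0.
have e0 (t : R) : 0 < expR t := expR_gt0 t.
have m0 t : 0 < m t by rewrite invr_gt0 addr_gt0.
have mK t : (expR t + expR (- t)) * m t =
  1 by rewrite mulfV // lt0r_neq0 // addr_gt0.
pose f (t : R) : E := m t *: (expR t *: xi + expR (- t) *: eta).
have fB s t : 1 - ip (f s) (f t) =
    (1 - k) * (expR s * expR (- t) + expR (- s) * expR t) * (m s * m t).
  have H := mK s; have H' := mK t.
  rewrite /f !ipE x1 y1 (ipC eta xi) -/k.
  set S := expR s in H *; set S' := expR (- s) in H *.
  set T := expR t in H' *; set T' := expR (- t) in H' *.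
  have HH : ((S + S') * m s) * ((T + T') * m t) = 1 by rewrite H H' mulr1.
  by apply: (eq_lincomb (c := -1) HH); lra.
have fBB t : 1 - ip (f t) (f t) = (2 * (1 - k)) * m t ^+ 2.
  by rewrite fB; apply: (eq_lincomb (c := 2 * (1 - k) * m t ^+ 2) (eK t)); lra.
have f1 t : ip (f t) (f t) < 1.
  by rewrite -subr_gt0 fBB; apply: mulr_gt0; [rewrite mulr_gt0|rewrite exprn_gt0].
exists (fun t => mkhball (f1 t)).
  move=> s t _ _; rewrite hdistE !set_val_mkhball -acosh_ch; congr acosh.
  have dE u : dgamma (f u) = Num.sqrt (2 * (1 - k)) * m u.
    rewrite /dgamma -ipxx fBB sqrtrM; last by rewrite mulr_ge0 // ltW.
    by rewrite sqrtr_sqr gtr0_norm.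
  set Q := Num.sqrt _ in dE *.
  have QE : Q ^+ 2 = 2 * (1 - k) by rewrite sqr_sqrtr // mulr_ge0 // ltW.
  have den : 0 < 2 * (1 - k) * (m s * m t).
    by apply: mulr_gt0; apply: mulr_gt0.
  rewrite /hratio !dE fB.
  have -> : Q * m s * (Q * m t) = 2 * (1 - k) * (m s * m t) by rewrite -QE; lra.
  apply: (mulIf (lt0r_neq0 den)); rewrite divfK ?lt0r_neq0 //.
  by rewrite /ch opprB !expRD; lra.
move=> th th0 th1.
have r0 : 0 < th / (1 - th) by rewrite divr_gt0 // subr_gt0.
(* The weights of [xi] and [eta] at time t have ratio e^(2t), so t = ln a. *)
pose a := Num.sqrt (th / (1 - th)).
have a0 : 0 < a by rewrite sqrtr_gt0.
have aa : a ^+ 2 * (1 - th) = th.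
  by rewrite sqr_sqrtr ?ltW // divfK // lt0r_neq0 // subr_gt0.
exists (ln a); rewrite set_val_mkhball /f scalerDr !scalerA.
have H := mK (ln a); have H' := eK (ln a).
move: H H'; rewrite lnK ?posrE //; set a' := expR (- ln a) => H H'.
have A : a' * th = a * (1 - th).
  by rewrite -{1}aa; apply: (eq_lincomb (c := a * (1 - th)) H'); lra.
congr (_ *: _ + _ *: _).
  transitivity (m (ln a) * ((a + a') * th)); first by congr (_ * _); lra.
  by apply: (eq_lincomb (c := th) H); lra.
transitivity (m (ln a) * ((a + a') * (1 - th))); first by congr (_ * _); lra.
by apply: (eq_lincomb (c := 1 - th) H); lra.
Qed.

(** * Totally geodesic subspaces *)

Lemma closed_hball_approx (S : set (hball E)) (z : hball E) : closed S ->
  (forall e : R, 0 < e -> exists2 y, S y & `|set_val z - set_val y| < e) -> S z.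
Proof.
move=> cS Sz.
have [u Su] : {u : nat -> hball E &
    forall n, S (u n) /\ `|set_val z - set_val (u n)| < n.+1%:R^-1}.
  apply: (choice (P := fun n y =>
    S y /\ `|set_val z - set_val y| < n.+1%:R^-1)) => n.
  by have [|y] := Sz n.+1%:R^-1; [rewrite invr_gt0 ltr0n|exists y].
apply: (closed_hball_lim (u := u) cS); first by exists 0%N => // n _; case: (Su n).
apply: (cvg_norm_bound (b := fun n => n.+1%:R^-1)) => [n|];
  last exact: cvg_harmonic.
by apply: ltW; case: (Su n).
Qed.

Section TotallyGeodesic.
Context (S : set (hball E)).
Context (Sgeo : totally_geodesic ip S).

(** The line through [x] and [y] meets the unit sphere at the roots [r1] < [r2] of a quadratic
    polynomial, and the geodesic joining these two points at infinity runs through [x], [y] and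
    [z]. *)
Lemma totally_geodesic_line (x y z : hball E) (r : R) : S x -> S y -> x != y ->
  set_val z = set_val x + r *: (set_val y - set_val x) -> S z.
Proof.
move=> Sx Sy xy; have [w wE] : exists w, w = set_val y - set_val x by eexists.
rewrite -wE => zE; have w0 : w != 0.
  by rewrite wE; apply: contra_neq xy => /eqP; rewrite subr_eq0 => /eqP/esym;
    exact: hball_inj.
pose A := ip w w; pose B := ip (set_val x) w; pose C :=
  ip (set_val x) (set_val x) - 1.
have A0 : 0 < A by rewrite lt_def ip_ge0 andbT; apply: contra_neq w0 => /ip_eq0.
have C0 : C < 0 by rewrite subr_lt0 hball_ip_lt1.
pose D := Num.sqrt (B ^+ 2 - A * C).
have DD : D ^+ 2 = B ^+ 2 - A * C by rewrite sqr_sqrtr; nra.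
have D0 : 0 < D by rewrite sqrtr_gt0; nra.
pose P (t : R) := set_val x + t *: w.
have PP t : ip (P t) (P t) - 1 = A * t ^+ 2 + 2 * B * t + C.
  by rewrite /P !ipE -/A (ipC w) -/B /C; lra.
pose r1 := (- B - D) / A; pose r2 := (- B + D) / A.
have Ar1 : A * r1 = - B - D by rewrite mulrC divfK // lt0r_neq0.
have Ar2 : A * r2 = - B + D by rewrite mulrC divfK // lt0r_neq0.
have root t : (A * t = - B - D \/ A * t = - B + D) -> ip (P t) (P t) = 1.
  move=> H; apply/eqP; rewrite -subr_eq0 PP; apply/eqP/(mulfI (lt0r_neq0 A0)).
  have -> : A * (A * t ^+ 2 + 2 * B * t + C) = (A * t) ^+ 2 + 2 * B * (A * t) +
    A * C by lra.
  by case: H => ->; lra.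
have in12 t : ip (P t) (P t) < 1 -> r1 < t /\ t < r2.
  rewrite -subr_lt0 PP => H.
  have : A * (A * t ^+ 2 + 2 * B * t + C) < 0 by rewrite pmulr_rlt0.
  have -> : A * (A * t ^+ 2 + 2 * B * t + C) = (A * t + B) ^+ 2 - D ^+ 2 by lra.
  move=> {}H; have : `|A * t + B| < D.
    by rewrite -(@ltr_pXn2r _ 2) ?nnegrE ?(ltW D0) // real_normK ?num_real //; lra.
  by rewrite ltr_norml => /andP[? ?]; split; rewrite -(ltr_pM2l A0) ?Ar1 ?Ar2; lra.
have r12 : r1 < r2 by rewrite -(ltr_pM2l A0); lra.
have [||| gamma geo gP] := @chord_geodesic (P r2) (P r1).
- by apply: root; right.
- by apply: root; left.
- rewrite /P (inj_eq (addrI _)); apply: contra_neq w0 => /eqP.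
  by rewrite -subr_eq0 -scalerBl scaler_eq0 subr_eq0 gt_eqF //= => /eqP.
have on_gamma (v : hball E) t : set_val v = P t -> exists s, gamma s = v.
  move=> vt; have /in12[t1 t2] : ip (P t) (P t) < 1 by rewrite -vt hball_ip_lt1.
  have [s sE] : exists s, set_val (gamma s) =
      ((t - r1) / (r2 - r1)) *: P r2 + (1 - (t - r1) / (r2 - r1)) *: P r1.
    apply: gP; first by rewrite divr_gt0 // subr_gt0.
    by rewrite ltr_pdivrMr ?subr_gt0 // mul1r ltrD2r.
  exists s; apply: hball_inj; rewrite sE vt /P.
  have dE : (t - r1) / (r2 - r1) * (r2 - r1) = t - r1.
    by rewrite divfK // subr_eq0 gt_eqF.
  set th := _ / _ in dE *; rewrite !scalerDr !scalerA addrACA -!scalerDl.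
  have -> : th + (1 - th) = 1 by lra.
  have -> : th * r2 + (1 - th) * r1 = t by lra.
  by rewrite scale1r.
have [s0 g0] := on_gamma x 0 (ltac:(by rewrite /P scale0r addr0)).
have [s1 g1] := on_gamma y 1 (ltac:(by rewrite /P scale1r wE addrC subrK)).
have [s2 <-] := on_gamma z r zE.
apply: (Sgeo.2 gamma geo s0 s1); rewrite ?g0 ?g1 //.
by apply: contra_neq xy => s01; rewrite -g0 -g1 s01.
Qed.

Lemma totally_geodesic_comb2 (x y z : hball E) (a b : R) : S x -> S y ->
  a + b = 1 -> set_val z = a *: set_val x + b *: set_val y -> S z.
Proof.
move=> Sx Sy ab zE; have [xy|xy] := eqVneq x y.
  suff -> : z = x by [].
  by apply: hball_inj; rewrite zE -xy -scalerDl ab scale1r.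
apply: (totally_geodesic_line (x := x) (y := y) (r := b)) => //.
have aE : a = 1 - b by lra.
by rewrite zE aE scalerBl scale1r scalerBr addrAC -addrA.
Qed.

Lemma totally_geodesic_convex (x y : hball E) (a b : R) : S x -> S y ->
  0 <= a -> 0 <= b -> a + b = 1 ->
  exists2 z, S z & set_val z = a *: set_val x + b *: set_val y.
Proof.
move=> Sx Sy a0 b0 ab; pose m : E := a *: set_val x + b *: set_val y.
have m1 : ip m m < 1.
  have x1 : `|set_val x| < 1 := set_valP x; have y1 : `|set_val y| < 1 :=
    set_valP y.
  rewrite ipxx expr_lt1 //; apply: le_lt_trans (ler_normD _ _) _.
  rewrite !normrZ !ger0_norm //.
  have [a00|aN] := eqVneq a 0; first by rewrite a00 (_ : b = 1); lra.
  have ap : 0 < a by rewrite lt_def aN.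
  have := ltr_pM2l ap `|set_val x| 1; rewrite x1 => /idP H1.
  have := ler_wpM2l b0 (ltW y1); lra.
exists (mkhball m1) => //; exact: totally_geodesic_comb2 Sx Sy ab _.
Qed.

Lemma totally_geodesic_mid (x y : hball E) : S x -> S y ->
  exists2 z, S z & set_val z = 2^-1 *: (set_val x + set_val y).
Proof.
move=> Sx Sy; rewrite scalerDr.
by apply: totally_geodesic_convex => //; lra.
Qed.

Context (S0 : S (origin E)).

Lemma totally_geodesic_scale (y z : hball E) (r : R) : S y ->
  set_val z = r *: set_val y -> S z.
Proof.
move=> Sy zE; apply: (totally_geodesic_comb2 (a := 1 - r) (b := r) S0 Sy).
  by rewrite subrK.
by rewrite zE scaler0 add0r.
Qed.

(** The linear span of [S], for [S] totally geodesic through the origin: such a set is closed under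
    affine combinations only inside the ball, so vectors are first scaled down. *)
Definition in_cone (x : E) : Prop :=
  exists2 e : R, 0 < e & exists2 y : hball E, S y & set_val y = e *: x.

Lemma in_cone_shrink (y : hball E) (r : R) : S y -> `|r| <= 1 ->
  exists2 z, S z & set_val z = r *: set_val y.
Proof.
move=> Sy r1; have z1 : ip (r *: set_val y) (r *: set_val y) < 1.
  rewrite !ipE mulrA; apply: le_lt_trans (hball_ip_lt1 y).
  rewrite ler_piMl ?ip_ge0 // -expr2 -real_normK ?num_real //.
  by rewrite expr_le1.
by exists (mkhball z1) => //; exact: totally_geodesic_scale Sy _.
Qed.

Lemma in_cone_scale a x : in_cone x -> in_cone (a *: x).
Proof.
move=> [e e0 [y Sy yE]]; pose c := (1 + `|a|)^-1.
have c0 : 0 < c by rewrite invr_gt0 ltr_wpDr.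
have ca : `|c * a| <= 1.
  by rewrite normrM gtr0_norm // mulrC ler_pdivrMr ?ltr_wpDr // mul1r lerDr.
have [z Sz zE] := in_cone_shrink Sy ca.
exists (c * e); first exact: mulr_gt0.
by exists z => //; rewrite zE yE !scalerA mulrAC.
Qed.

Lemma in_cone_add x y : in_cone x -> in_cone y -> in_cone (x + y).
Proof.
move=> [e e0 [x' Sx xE]] [f f0 [y' Sy yE]]; pose m := Num.min e f.
have m0 : 0 < m by rewrite lt_min e0.
have me : `|m / e| <= 1.
  by rewrite gtr0_norm ?divr_gt0 // ler_pdivrMr // mul1r ge_min lexx.
have mf : `|m / f| <= 1.
  by rewrite gtr0_norm ?divr_gt0 // ler_pdivrMr // mul1r ge_min lexx orbT.
have [u Su uE] := in_cone_shrink Sx me; have [v Sv vE] := in_cone_shrink Sy mf.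
have [z Sz zE] := totally_geodesic_mid Su Sv.
exists (2^-1 * m); first by rewrite mulr_gt0.
exists z => //; rewrite zE uE vE xE yE !scalerA !divfK ?lt0r_neq0 //.
by rewrite -scalerDr scalerA.
Qed.

Lemma totally_geodesic_full (X : Type) (p : X -> hball E) :
  (forall v, S (p v)) -> spanning (set_val \o p) -> S = setT.
Proof.
move=> Sp sp; have cone s : in_cone (comb (set_val \o p) s).
  elim: s => [|[a v] s IH].
    by exists 1 => //; exists (origin E) => //; rewrite /comb big_nil scaler0.
  rewrite /comb big_cons; apply: in_cone_add => //=; apply: in_cone_scale.
  by exists 1 => //; exists (p v) => //; rewrite scale1r.
apply/seteqP; split=> // z _; apply: (closed_hball_approx Sgeo.1) => e e0.
have z1 : 0 < 1 - `|set_val z| by rewrite subr_gt0; exact: set_valP z.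
(* The bound 1 - |z| keeps the approximating combination inside the ball. *)
have [|s] := sp (set_val z) (Num.min e (1 - `|set_val z|)).
  by rewrite lt_min e0.
rewrite lt_min => /andP[se s1].
have c1 : ip (comb (set_val \o p) s) (comb (set_val \o p) s) < 1.
  rewrite ipxx expr_lt1 // -(subrK (set_val z) (comb _ _)).
  by apply: le_lt_trans (ler_normD _ _) _; rewrite distrC; lra.
exists (mkhball c1) => //; have [f f0 [y Sy yE]] := cone s.
apply: (totally_geodesic_scale (r := f^-1) Sy).
by rewrite set_val_mkhball yE scalerA mulVf ?lt0r_neq0 // scale1r.
Qed.

End TotallyGeodesic.
(** * Embedding the tree *)

(* The spherical function of the 3-regular tree with eigenvalue 3/2. *)
Definition sph (n : nat) : R := (5 * 2 ^+ n + 2 * 4^-1 ^+ n) / 7.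

Lemma sph0 : sph 0 = 1. Proof. by rewrite /sph !expr0; lra. Qed.
Lemma sph1 : sph 1 = 3 / 2. Proof. by rewrite /sph !expr1; lra. Qed.

Lemma sphSS n : sph n.+2 = 9 / 4 * sph n.+1 - 1 / 2 * sph n.
Proof. by rewrite /sph !exprS; lra. Qed.

Lemma sph2 : sph 2 = 23 / 8. Proof. by rewrite sphSS sph0 sph1; lra. Qed.

Lemma pow2_ge1 n : 1 <= 2 ^+ n :> R. Proof. by apply: exprn_ege1; lra. Qed.
Lemma pow4V_le1 n : 4^-1 ^+ n <= 1 :> R. Proof. by apply: exprn_ile1; lra. Qed.
Lemma pow4V_gt0 n : 0 < 4^-1 ^+ n :> R. Proof. by apply: exprn_gt0; lra. Qed.

Lemma sphS_ge n : 3 / 2 * sph n <= sph n.+1.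
Proof.
by rewrite /sph !exprS; have := pow2_ge1 n; have := pow4V_le1 n; lra.
Qed.

Lemma sphS_le n : sph n.+1 <= 9 / 4 * sph n.
Proof.
by rewrite /sph !exprS; have := pow2_ge1 n; have := pow4V_gt0 n; lra.
Qed.

Lemma sph_ge1 n : 1 <= sph n.
Proof.
elim: n => [|n IH]; first by rewrite sph0.
by have := sphS_ge n; lra.
Qed.

Lemma sph_gt0 n : 0 < sph n. Proof. exact: lt_le_trans ltr01 (sph_ge1 n). Qed.

Lemma sph_neq0 n : sph n != 0. Proof. exact: lt0r_neq0 (sph_gt0 n). Qed.

Lemma sph_le m n : (m <= n)%N -> sph m <= sph n.
Proof.
move=> /subnK <-; elim: (n - m)%N => // k; rewrite addSn => /le_trans; apply.
by have := sphS_ge (k + m); have := sph_gt0 (k + m); lra.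
Qed.

(** The difference is 10/49 (2^m - 4^-m) (2^n - 4^-n). *)
Lemma sph_mul_le m n : sph m * sph n <= sph (m + n).
Proof.
rewrite /sph !exprD; have := pow2_ge1 m; have := pow4V_le1 m.
have := pow2_ge1 n; have := pow4V_le1 n.
set a := 2 ^+ m; set b := 2 ^+ n; set c := 4^-1 ^+ m; set d := 4^-1 ^+ n => *.
have : 0 <= (a - c) * (b - d) by rewrite mulr_ge0 // subr_ge0; lra.
lra.
Qed.

(** The factor 7/5 is the inverse of the leading coefficient 5/7 of [sph]. Being less than 2, it
    keeps inner products of vertices away from -1. *)
Lemma sph_add_le m n : sph (m + n) <= 7 / 5 * (sph m * sph n).
Proof.
rewrite /sph !exprD; have := pow2_ge1 m; have := pow4V_gt0 m; have := pow4V_le1 m.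
have := pow2_ge1 n; have := pow4V_gt0 n.
set a := 2 ^+ m; set b := 2 ^+ n; set c := 4^-1 ^+ m; set d := 4^-1 ^+ n => *.
have : 0 <= (a - c) * d by rewrite mulr_ge0 //; lra.
have : 0 <= c * b by rewrite mulr_ge0 //; lra.
have : 0 <= c * d by rewrite mulr_ge0 //; lra.
lra.
Qed.

Lemma sph_ge_linear n : n.+1%:R / 2 <= sph n.
Proof.
elim: n => [|n IH]; first by rewrite sph0; lra.
by have := sphS_ge n; have := sph_ge1 n; rewrite -[n.+2%:R]natr1; lra.
Qed.

Lemma sph_inv_le n : (sph n)^-1 <= 2 * n.+1%:R^-1.
Proof.
have n0 : 0 < n.+1%:R :> R by rewrite ltr0n.
rewrite -[2]invrK -invfM lef_pV2 ?posrE ?mulr_gt0 ?invr_gt0 ?sph_gt0 //.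
by rewrite mulrC; exact: sph_ge_linear.
Qed.

Lemma sph_unbounded (M : R) : exists n, M < sph n.
Proof.
have [n Mn] : exists n : nat, 2 * M < n%:R.
  by exists (Num.truncn `|2 * M|).+1; apply: le_lt_trans (ler_norm _) _;
    exact: truncnS_gt.
by exists n; apply: lt_le_trans (sph_ge_linear n); rewrite -natr1; lra.
Qed.

Lemma ip_ext x y : (forall z, ip x z = ip y z) -> x = y.
Proof.
move=> xy; apply/eqP; rewrite -subr_eq0; apply/eqP/ip_eq0.
by rewrite ipDl ipNl xy subrr.
Qed.

Section Embedding.
Context (b : option word -> E).
Context (b_orthonormal : forall s t, ip (b s) (b t) = (s == t)%:R).

(** k0^2 = sph(1)^2 - 1 is the squared length of the vectors at the neighbours of the root. Siblings
    are at distance 2 and differ by 2 k1 times a unit vector, so (2 k1)^2 = 2 (sph(2) - 1) =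
    15/4. *)
Let k0 : R := Num.sqrt (5 / 4).
Let k1 : R := Num.sqrt (15 / 16).

Lemma k0_sqr : k0 * k0 = 5 / 4. Proof. by rewrite -expr2 sqr_sqrtr //; lra. Qed.
Lemma k1_sqr : k1 * k1 = 15 / 16. Proof. by rewrite -expr2 sqr_sqrtr //; lra. Qed.
Lemma k0_gt0 : 0 < k0. Proof. by rewrite sqrtr_gt0; lra. Qed.
Lemma k1_gt0 : 0 < k1. Proof. by rewrite sqrtr_gt0; lra. Qed.

(* The three directions at the root form an equilateral triangle. *)
Definition root_dir (x : letter) : E :=
  match x with
  | None => k0 *: b (Some tree_root)
  | Some true => (- (k0 / 2)) *: b (Some tree_root) + k1 *: b None
  | Some false => (- (k0 / 2)) *: b (Some tree_root) - k1 *: b None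
  end.

(** The direction in which the two children of a vertex other than the root separate. The recursion
    runs on raw sequences, so [insub] recovers the vertex; non-reduced sequences give 0. *)
Definition branch_dir (s : seq letter) : E :=
  if insub s is Some w then b (Some w) else 0.

Definition edge_dir (s : seq letter) : E :=
  match s with
  | [::] => 0
  | [:: x] => root_dir x
  | x :: (y :: _) as t => (if x == next_letter y then k1 else - k1) *: branch_dir t
  end.

(* The recursion is forced by harmonicity: the lifts P v = (sph |v|, tree_vec v)
   of the vertices to the hyperboloid satisfy
   sum_(w adjacent to v) P w = (9/2) P v. *)
Fixpoint tree_vec (s : seq letter) : E :=
  match s with
  | [::] => 0
  | x :: t => (if t is y :: u then (9 / 4) *: tree_vec t - (1 / 2) *: tree_vec u
               else 0) + edge_dir s
  end.

Lemma tree_vec1 x : tree_vec [:: x] = root_dir x.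
Proof. by rewrite /= add0r. Qed.

Lemma tree_vec_cons x y s : tree_vec (x :: y :: s) =
  (9 / 4) *: tree_vec (y :: s) - (1 / 2) *: tree_vec s + edge_dir (x :: y :: s).
Proof. by []. Qed.

Lemma ip_tree_vec_consl x y s z : ip (tree_vec (x :: y :: s)) z =
  9 / 4 * ip (tree_vec (y :: s)) z - 1 / 2 * ip (tree_vec s) z +
  ip (edge_dir (x :: y :: s)) z.
Proof.
rewrite tree_vec_cons; move: (tree_vec _) (tree_vec _) (edge_dir _) => a c d.
by rewrite !ipE.
Qed.

Lemma branch_dirE (w : word) : branch_dir w = b (Some w).
Proof. by rewrite /branch_dir valK. Qed.

Lemma ip_root_dir x y :
  ip (root_dir x) (root_dir y) = if x == y then 5 / 4 else - (5 / 8).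
Proof.
have K0 := k0_sqr; have K1 := k1_sqr.
by case: x => [[]|]; case: y => [[]|] /=;
  rewrite !ipE !b_orthonormal /= ?eqxx /=; lra.
Qed.

Lemma reduced_consE x y s : reduced (x :: y :: s) = (x != y) && reduced (y :: s).
Proof. by []. Qed.

Lemma ip_edge_dir (s t : seq letter) : reduced s -> reduced t ->
  (0 < size s)%N -> (0 < size t)%N ->
  ip (edge_dir s) (edge_dir t) =
  if behead s == behead t then
    if size s == 1%N then (if s == t then 5 / 4 else - (5 / 8))
    else (if s == t then 15 / 16 else - (15 / 16))
  else 0.
Proof.
have K1 := k1_sqr.
case: s => // x [|y s] rs; case: t => // x' [|y' t] rt _ _.
- by rewrite /= ip_root_dir eqseq_cons eqxx andbT.
- rewrite [RHS]/=; move: rt; rewrite reduced_consE => /andP[_ rt].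
  rewrite /edge_dir -[y' :: t]/(letters (Word rt)) branch_dirE.
  by case: x rs => [[]|] _ /=; rewrite !ipE !b_orthonormal /=; lra.
- rewrite [RHS]/=; move: rs; rewrite reduced_consE => /andP[_ rs].
  rewrite /edge_dir -[y :: s]/(letters (Word rs)) branch_dirE.
  by case: x' rt => [[]|] _ /=; rewrite !ipE !b_orthonormal /=; lra.
- move: rs rt; rewrite !reduced_consE => /andP[xy rs] /andP[xy' rt].
  rewrite /edge_dir [behead _]/= [behead (_ :: _ :: t)]/= [size _]/=.
  have -> : branch_dir (y :: s) = b (Some (Word rs)) by rewrite -branch_dirE.
  have -> : branch_dir (y' :: t) = b (Some (Word rt)) by rewrite -branch_dirE.
  rewrite ipZl // ipZr // b_orthonormal.
  have -> : (Some (Word rs) == Some (Word rt)) = (y :: s == y' :: t) by [].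
  case: (eqVneq (y :: s) (y' :: t)) => [E1|_]; last by rewrite !mulr0.
  rewrite E1 eqseq_cons eqxx andbT mulr1.
  move: E1 xy' => [<- _]; case: (eqVneq x x') => [<- _|xx xy'].
    by case: ifP => _ /=; lra.
  (* Of two distinct letters other than [y], exactly one is [next_letter y]: siblings get opposite
     signs. *)
  by case: x x' y xx xy xy' {rs} => [[]|] [[]|] [[]|] //= _ _ _; lra.
Qed.

(** [tree_vec t] combines the edge directions of suffixes of [t], all shorter than [s] and thus
    orthogonal to its direction. *)
Lemma ip_edge_dir_vec (s t : seq letter) : reduced s -> reduced t ->
  (size t < size s)%N -> ip (edge_dir s) (tree_vec t) = 0.
Proof.
move=> rs; have [n] := ubnP (size t); elim: n t => // n IH [|x t] le_n rt ts.
  by rewrite ip0r.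
have E1 : ip (edge_dir s) (edge_dir (x :: t)) = 0.
  rewrite ip_edge_dir //; last exact: leq_ltn_trans ts.
  case: eqP => // /(congr1 size); rewrite size_behead /=.
  by move=> EQ; move: ts; rewrite /= -EQ; case: (size s) => //= m; rewrite ltnn.
case: t rt ts le_n E1 => [|y t] rt ts le_n E1.
  by rewrite tree_vec1; exact: E1.
have r1 : reduced (y :: t) by exact: path_sorted rt.
have r2 : reduced t by exact: path_sorted r1.
have ts1 : (size (y :: t) < size s)%N by apply: leq_ltn_trans ts.
have ts2 : (size t < size s)%N by apply: leq_ltn_trans ts1.
have le2 : (size t < n)%N by exact: ltnW le_n.
by rewrite ipC ip_tree_vec_consl !(ipC _ (edge_dir s)) E1 (IH (y :: t)) // (IH t)
  //; lra.
Qed.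

(** The left side is minus the Lorentz product of the lifts. Extending the longer word, it obeys the
    recursion of [tree_vec], and the right side obeys that of [sph] since the distance grows by one
    per level. Only coinciding vertices, siblings, and a vertex with its parent need the initial
    values and the edge directions. *)
Lemma tree_vec_gram (s t : seq letter) : reduced s -> reduced t ->
  sph (size s) * sph (size t) - ip (tree_vec s) (tree_vec t) = sph (tdist s t).
Proof.
have [n] := ubnP (size s + size t); elim: n s t => // n IH s t le_n rs rt.
wlog ts : s t le_n rs rt / (size t <= size s)%N.
  move=> W; case: (leqP (size t) (size s)) => [|/ltnW] ts; first exact: W.
  by rewrite mulrC ipC tdistC; apply: W => //; rewrite addnC.
case: s rs ts le_n => [|x [|y u]] rs ts le_n.
- by case: t rt ts le_n => // *; rewrite ip0l sph0; lra.
- case: t rt ts le_n => [|z [|? ?]] // rt _ _.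
    by rewrite ip0r sph0 tdists0 /=; lra.
  rewrite !tree_vec1 ip_root_dir tdist_cons // eqseq_cons eqxx andbT tdistss sph1.
  by case: eqP => _; rewrite ?sph0 ?sph2; lra.
- have r1 : reduced (y :: u) by exact: path_sorted rs.
  have r2 : reduced u by exact: path_sorted r1.
  set s := x :: y :: u in rs ts le_n *.
  have E1 : sph (size s) * sph (size t) - ip (tree_vec s) (tree_vec t) =
      9 / 4 * (sph (size (y :: u)) * sph (size t) - ip (tree_vec (y :: u))
        (tree_vec t))
      - 1 / 2 * (sph (size u) * sph (size t) - ip (tree_vec u) (tree_vec t))
      - ip (edge_dir s) (tree_vec t).
    have -> : sph (size s) = 9 / 4 * sph (size (y :: u)) - 1 / 2 * sph (size u).
      exact: sphSS.
    by rewrite ip_tree_vec_consl; lra.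
  have szs : size s = (size u).+2 by [].
  have lt1 : (size (y :: u) + size t < n)%N by move: le_n; rewrite szs /=; lia.
  have lt2 : (size u + size t < n)%N by move: le_n; rewrite szs /=; lia.
  rewrite E1 (IH _ _ lt1 r1 rt) (IH _ _ lt2 r2 rt); clear E1 IH.
  case: (ltnP (size t) (size s)) => [ts'|st].
    rewrite ip_edge_dir_vec // subr0 [in RHS]/s (@tdist_consl x (y :: u)) //.
    case: (ltnP (size t) (size (y :: u))) => [ltu|leu].
      by rewrite tdist_consl // sphSS.
    (* If [t] is the parent of [s], the distances from [t] are 1, 0, 1 rather than monotone, and sph
       1 = 9/4 - 1/2 sph 1. *)
    have [->|ne] := eqVneq t (y :: u).
      by rewrite tdistss tdist_consr // tdistss sph0 sph1; lra.
    have {leu ts'} : size t = size (y :: u) by apply/eqP;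
      rewrite eqn_leq leu -ltnS ts'.
    case: t ne {rt ts le_n lt1 lt2} => // z t ne [st].
    have E2 : tdist (y :: u) (z :: t) = (tdist u t).+2.
      by rewrite tdist_cons // eq_sym (negPf ne).
    have E3 : tdist u (z :: t) = (tdist u t).+1 by rewrite tdist_consr ?st.
    by rewrite E2 E3 [RHS]sphSS.
  have {ts st} : size t = size s by apply/eqP; rewrite eqn_leq ts st.
  case: t rt le_n lt1 lt2 => [|x' [|y' u']] // rt le_n lt1 lt2 [st].
  have r1' : reduced (y' :: u') by exact: path_sorted rt.
  have r2' : reduced u' by exact: path_sorted r1'.
  have -> : ip (edge_dir s) (tree_vec [:: x', y' & u'])
      = ip (edge_dir s) (edge_dir [:: x', y' & u']).
    rewrite ipC ip_tree_vec_consl !(ipC _ (edge_dir s)).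
    by rewrite (@ip_edge_dir_vec s (y' :: u')) ?(@ip_edge_dir_vec s u') ?szs /=
      ?st //; lra.
  rewrite ip_edge_dir // [behead s]/= [behead (x' :: _)]/= [in RHS]/s
    (@tdist_cons x x' (y :: u) (y' :: u')); last by rewrite /= st.
  have E2 : tdist (y :: u) [:: x', y' & u'] = (tdist (y :: u) (y' :: u')).+1.
    by rewrite tdist_consr //= st.
  have E3 : tdist u [:: x', y' & u'] = (tdist u (y' :: u')).+1.
    by rewrite tdist_consr //= -st.
  (* With a common parent the edge term is 15/16 or -15/16, which separates distance 0 from distance
     2. *)
  rewrite E2 E3 szs /=; have [EQ|ne] := eqVneq (y :: u) (y' :: u').
    rewrite -EQ tdistss tdist_consr // tdistss sph1 sph2 /s !eqseq_cons !eqxx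
      !andbT.
    by case: eqP => _; rewrite ?sph0 ?sph2; lra.
  rewrite eqseq_cons (negPf ne) andbF subr0.
  have E4 : tdist (y :: u) (y' :: u') = (tdist u u').+2.
    by rewrite tdist_cons // (negPf ne).
  have E5 : tdist u (y' :: u') = (tdist u u').+1 by rewrite tdist_consr ?st.
  by rewrite E4 E5 [RHS]sphSS.
Qed.

Lemma tree_vec_norm_lt1 (v : word) :
  ip ((sph (size v))^-1 *: tree_vec v) ((sph (size v))^-1 *: tree_vec v) < 1.
Proof.
have := tree_vec_gram (letters_reduced v) (letters_reduced v).
rewrite tdistss sph0 ipZl ?ipZr // => G.
have s0 := sph_gt0 (size v); have i0 : 0 < (sph (size v))^-1 by rewrite invr_gt0.
have sK : sph (size v) * (sph (size v))^-1 = 1 by rewrite mulfV ?sph_neq0.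
set k := sph (size v) in G s0 i0 sK *; set k' := k^-1 in i0 sK *.
have -> : k' * (k' * ip (tree_vec v) (tree_vec v)) = (k * k') ^+ 2 - k' * k'.
  by rewrite [ip _ _](_ : _ = k * k - 1); lra.
by rewrite sK expr1n; have := mulr_gt0 i0 i0; lra.
Qed.

Definition tree_emb (v : word) : hball E := mkhball (tree_vec_norm_lt1 v).

Lemma tree_embE (v : word) : tree_vec v = sph (size v) *: set_val (tree_emb v).
Proof. by rewrite set_val_mkhball scalerA mulfV ?scale1r // sph_neq0. Qed.

Lemma tree_emb_root : tree_emb tree_root = origin E.
Proof. by apply: hball_inj; rewrite set_val_mkhball /= scaler0. Qed.

Lemma tree_emb_gram (v w : word) :
  sph (size v) * sph (size w) * (1 - ip (set_val (tree_emb v)) (set_val (tree_emb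
    w)))
  = sph (tdist v w).
Proof.
rewrite -(tree_vec_gram (letters_reduced v) (letters_reduced w)) !tree_embE.
by move: (set_val _) (set_val _) => x y; rewrite ipZl ipZr; lra.
Qed.

(** The edge directions of two siblings cancel, and the three at the root sum to zero. *)
Lemma tree_emb_harmonic (v : word) :
  tree_vec (step None v) + tree_vec (step (Some true) v) +
  tree_vec (step (Some false) v) = (9 / 2) *: tree_vec v.
Proof.
case: v => [[|y s] rs].
  apply: ip_ext => z; rewrite !letters_step /seq_step [letters _]/= !tree_vec1.
  by rewrite /= !ipE; lra.
have key : tree_vec (next_letter y :: y :: s) +
    tree_vec (next_letter (next_letter y) :: y :: s) + tree_vec s =
    (9 / 2) *: tree_vec (y :: s).
  have add3 (a c d z : E) : ip (a + c + d) z = ip a z + ip c z + ip d z.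
    by rewrite !ipDl.
  apply: ip_ext => z; rewrite add3 !ip_tree_vec_consl (ipZl _ (tree_vec _)).
  have -> : edge_dir (next_letter (next_letter y) :: y :: s) =
      - edge_dir (next_letter y :: y :: s).
    by rewrite /edge_dir eqxx -scaleNr; case: y {rs} => [[]|].
  by rewrite ipNl; lra.
rewrite !letters_step [letters _]/=; move: tree_vec key => Q.
by case: y {rs} => [[]|] /= <-; apply: ip_ext => z; rewrite !ipDl; lra.
Qed.

(** The recursion is inverted: an edge direction is a combination of the vectors of a vertex, its
    parent and its grandparent, and each basis vector comes from edge directions. *)
Lemma tree_emb_spanning : spanning b -> spanning (set_val \o tree_emb).
Proof.
move=> sb; apply: (spanning_trans sb) => o.
have vecE (v : word) : exists t, tree_vec v = comb (set_val \o tree_emb) t.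
  exists [:: (sph (size v), v)].
  by rewrite tree_embE /comb big_seq1.
have lin (a c : R) (x y : E) : (exists t, x = comb (set_val \o tree_emb) t) ->
    (exists t, y = comb (set_val \o tree_emb) t) ->
    exists t, a *: x + c *: y = comb (set_val \o tree_emb) t.
  move=> [t ->] [u ->]; rewrite !comb_scale -comb_cat.
  by eexists.
have K0 := lt0r_neq0 k0_gt0; have K1 := lt0r_neq0 k1_gt0.
have dirE x : exists t, root_dir x = comb (set_val \o tree_emb) t.
  by have := vecE (step x tree_root); rewrite [letters _]/= tree_vec1.
have broot : exists t, b (Some tree_root) = comb (set_val \o tree_emb) t.
  have -> : b (Some tree_root) = k0^-1 *: root_dir None + 0 *: 0.
    by rewrite scaler0 addr0 scalerA mulVf // scale1r.
  by apply: lin; [exact: dirE|exists [::]; rewrite /comb big_nil].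
case: o => [w|]; last first.
  have -> : b None = k1^-1 *: root_dir (Some true) +
    (k1^-1 * (k0 / 2)) *: b (Some tree_root).
    by rewrite /= scalerDr !scalerA mulVf // scale1r mulrN scaleNr addrAC addNr
      add0r.
  exact: lin.
case: w => [[|y s] rs].
  by have -> : Word rs = tree_root by exact: letters_inj.
have rv : reduced (next_letter y :: y :: s).
  by rewrite reduced_consE rs andbT; case: y {rs} => [[]|].
have rs' : reduced s by exact: path_sorted rs.
have E1 : b (Some (Word rs)) = k1^-1 *: edge_dir (next_letter y :: y :: s) + 0 *: 0.
  by rewrite scaler0 addr0 /edge_dir eqxx -[y :: s]/(letters (Word rs))
    branch_dirE scalerA mulVf // scale1r.
rewrite {}E1; apply: (lin); last by exists [::]; rewrite /comb big_nil.
have -> : edge_dir (next_letter y :: y :: s) =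
  1 *: tree_vec (next_letter y :: y :: s) +
   (-1) *: ((9 / 4) *: tree_vec (y :: s) + (- (1 / 2)) *: tree_vec s).
  by rewrite tree_vec_cons scale1r scaleN1r scaleNr addrAC subrr add0r.
apply: (lin); first exact: (vecE (Word rv)).
by apply: lin; [exact: (vecE (Word rs))|exact: (vecE (Word rs'))].
Qed.

End Embedding.

Lemma infinite_words : infinite_set [set: option word].
Proof.
apply/infiniteP/pcard_injP; exists (fun n => Some (ray None n)).
by move=> m n _ _ /= [/(congr1 size)];
  rewrite -!/(size (letters (ray None _))) !size_ray.
Qed.

Lemma tree_embedding : separable E -> infinite_dimensional E ->
  exists p : word -> hball E, [/\ p tree_root = origin E,
    forall v w : word, sph (size v) * sph (size w) *
      (1 - ip (set_val (p v)) (set_val (p w))) = sph (tdist v w),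
    forall v : word, let Q u := sph (size (letters u)) *: set_val (p u) in
      Q (step None v) + Q (step (Some true) v) + Q (step (Some false) v) =
      (9 / 2) *: Q v
    & spanning (set_val \o p)].
Proof.
move=> sE iE.
have [b bo bs] := orthonormal_basis infinite_words sE iE.
exists (tree_emb bo); split.
- exact: tree_emb_root.
- by move=> v w; exact: tree_emb_gram.
- by move=> v; have := tree_emb_harmonic b v; rewrite !(tree_embE bo).
- exact: tree_emb_spanning.
Qed.

(** * Groups of tree automorphisms acting on the hyperbolic space *)

Lemma lim_le (u : nat -> R) (l c : R) :
  (forall n, u n <= c) -> u n @[n --> \oo] --> l -> l <= c.
Proof.
move=> uc; apply: (@closed_cvg _ _ \oo _ u [set x | x <= c]).
  exact: closed_le.
by exists 0%N => // n _; exact: uc.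
Qed.

Lemma lim_ge (u : nat -> R) (l c : R) :
  (forall n, c <= u n) -> u n @[n --> \oo] --> l -> c <= l.
Proof.
move=> uc; apply: (@closed_cvg _ _ \oo _ u [set x | c <= x]).
  exact: closed_ge.
by exists 0%N => // n _; exact: uc.
Qed.

Lemma finite_words N : finite_set [set v : word | (size v <= N)%N].
Proof.
have fin_seq : finite_set [set s : seq letter | (size s <= N)%N].
  elim: N => [|N IH].
    apply: (@sub_finite_set _ _ [set [::]]); last exact: finite_set1.
    by move=> s /=; rewrite leqn0 size_eq0 => /eqP.
  apply: (@sub_finite_set _ _ ([set [::]] `|` \bigcup_(x in [set: letter])
      [set x :: s | s in [set s : seq letter | (size s <= N)%N]])).
    by move=> [|x s] /= sN; [left|right; exists x => //; exists s].
  rewrite finite_setU; split; first exact: finite_set1.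
  by apply: bigcup_finite => [|x _]; [exact: finite_finset|exact: finite_image].
apply: (finite_preimage (f := letters)) fin_seq.
by move=> v w _ _; exact: letters_inj.
Qed.

Section TreeGroup.
Context (p : word -> hball E).
Local Notation P v := (set_val (p v)).
Context (p_root : p tree_root = origin E).
Context (p_gram : forall v w : word,
  sph (size v) * sph (size w) * (1 - ip (P v) (P w)) = sph (tdist v w)).
Context (p_harmonic : forall v : word,
  let Q u := sph (size (letters u)) *: P u in
  Q (step None v) + Q (step (Some true) v) + Q (step (Some false) v) =
  (9 / 2) *: Q v).
Context (p_span : spanning (set_val \o p)).

Lemma p_ip (v w : word) :
  ip (P v) (P w) = 1 - sph (tdist v w) / (sph (size v) * sph (size w)).
Proof.
have s0 : sph (size v) * sph (size w) != 0 by rewrite mulf_neq0 // sph_neq0.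
by rewrite -p_gram mulrAC mulfV // mul1r opprB addrCA subrr addr0.
Qed.

Lemma p_ipxx (v : word) : ip (P v) (P v) = 1 - (sph (size v))^-1 ^+ 2.
Proof. by rewrite p_ip tdistss sph0 div1r invfM expr2. Qed.

Lemma dgamma_p v : dgamma (P v) = (sph (size v))^-1.
Proof.
by rewrite /dgamma -ipxx p_ipxx opprB addrCA subrr addr0 sqrtr_sqr ger0_norm //
  invr_ge0 ltW // sph_gt0.
Qed.

Lemma hratio_p v w : hratio (P v) (P w) = sph (tdist v w).
Proof. by rewrite /hratio !dgamma_p -invfM invrK mulrC p_gram. Qed.

Lemma p_inj : injective p.
Proof.
move=> v w vw; have : sph (tdist v w) = 1.
  by rewrite -hratio_p vw hratio_p tdistss sph0.
case vwn : (tdist v w) => [|n] s1; first exact/letters_inj/tdist_eq0.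
by exfalso; have := sphS_ge n; rewrite s1; have := sph_ge1 n; lra.
Qed.

Lemma tree_aut_isometry f : tree_aut f ->
  exists2 g, Isom ip g & forall v, g (p v) = p (f v).
Proof.
move=> [bf df]; apply: (isometry_extension p_span p_root bf) => v w.
by apply/hdist_inj; rewrite !hratio_p df.
Qed.

(** As [g] permutes the vertices, the distances from [g x] to all vertices are prescribed. *)
Lemma isometry_eq g g' : Isom ip g -> Isom ip g' ->
  (exists f : word -> word, bijective f /\ forall v, g (p v) = p (f v)) ->
  (forall v, g (p v) = g' (p v)) -> g = g'.
Proof.
move=> [_ ig] [_ ig'] [f [[f' fK f'K] gf]] gg; apply/funext => x.
apply: (hdist_separates p_span p_root) => w.
by rewrite -[w]f'K -gf ig gg ig'.
Qed.

(** * Ends of the tree and the limit set *)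

Definition ray_end (x : letter) (xi : E) : Prop :=
  P (ray x n) @[n --> \oo] --> xi.

(** By [sph_mul_le], points n <= m of the ray are at squared norm distance at most sph(n)^-2. *)
Lemma ray_end_exists x : exists xi, ray_end x xi.
Proof.
apply: cauchy_lim => e e0; have [N NP] := sph_unbounded (2 / e).
exists N => n m; wlog nm : n m / (n <= m)%N.
  move=> W Nn Nm; case: (leqP n m) => [|/ltnW] nm; first exact: W.
  by rewrite distrC; apply: W.
move=> Nn _; have sn : 2 / e < sph n := lt_le_trans NP (sph_le Nn).
have sn0 := sph_gt0 n; have i0 : 0 < (sph n)^-1 by rewrite invr_gt0.
have se : 2 * (sph n)^-1 < e.
  by rewrite ltr_pdivrMr // mulrC -ltr_pdivrMr.
apply: le_lt_trans se.
rewrite -(@ler_pXn2r _ 2) ?nnegrE ?mulr_ge0 ?(ltW i0) // -ipxx ip_subxx !p_ipxx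
  p_ip.
rewrite !size_ray tdistC -{1}(subnKC nm) tdist_ray.
have sm0 := sph_gt0 m; have sK : sph n * sph (m - n) <= sph m.
  by rewrite -{2}(subnKC nm) sph_mul_le.
have : sph (m - n) / (sph n * sph m) <= (sph n)^-1 ^+ 2.
  rewrite invfM expr2 mulrCA ler_pM2l //.
  by rewrite ler_pdivrMr // mulrC ler_pdivlMr // mulrC.
by have := sqr_ge0 (sph m)^-1; have := sqr_ge0 (sph n)^-1; lra.
Qed.

Lemma harmonic2_cvg0 : 2 * n.+1%:R^-1 @[n --> \oo] --> (0 : R).
Proof.
by rewrite -(mulr0 2); apply: cvgM; [exact: cvg_cst|exact: cvg_harmonic].
Qed.

Lemma ray_end_norm x xi : ray_end x xi -> ip xi xi = 1.
Proof.
move=> xiP; have A := ip_cvg xiP xiP; apply: (cvg_unique (@norm_hausdorff _ R^o) A).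
apply: (cvg_norm_bound (V := R^o) _ harmonic2_cvg0) => n; rewrite p_ipxx size_ray.
rewrite opprB addrCA subrr addr0 ger0_norm ?sqr_ge0 //.
apply: le_trans (sph_inv_le n); rewrite expr2.
have i0 : 0 < (sph n)^-1 by rewrite invr_gt0 sph_gt0.
by rewrite ler_piMl ?(ltW i0) // invf_le1 ?sph_ge1 // sph_gt0.
Qed.

Lemma ray_end_ip x y xi eta : x != y -> ray_end x xi -> ray_end y eta ->
  ip xi eta <= 0.
Proof.
move=> xy xiP etaP; apply: lim_le (ip_cvg xiP etaP) => n.
rewrite p_ip !size_ray tdist_ray_neq // subr_le0 ler_pdivlMr ?mulr_gt0 ?sph_gt0 //.
by rewrite mul1r sph_mul_le.
Qed.

Definition tree_limit_set : set E := [set xi | hboundary E xi /\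
  exists v : nat -> word, P (v n) @[n --> \oo] --> xi].

Lemma ray_end_limit x xi : ray_end x xi -> tree_limit_set xi.
Proof.
move=> xiP; split; last by exists (ray x).
rewrite /hboundary /=; apply/eqP.
by rewrite -(@eqrXn2 _ 2) // expr1n -ipxx (ray_end_norm xiP).
Qed.

(** The antipode of an end is not a limit point: inner products of vertices are at least 1 - 7/5 =
    -2/5 by [sph_add_le]. *)
Lemma tree_limit_set_neq : tree_limit_set <> hboundary E.
Proof.
move=> EQ; have [xi xiP] := ray_end_exists None.
have [xi1 _] := ray_end_limit xiP.
have : tree_limit_set (- xi) by rewrite EQ /hboundary /= normrN.
move=> [_ [v vP]]; have := ip_cvg xiP vP; rewrite ipNr (ray_end_norm xiP).
move=> H; suff : - (2 / 5) <= - 1 :> R by lra.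
apply: lim_ge H => n; rewrite p_ip.
have s0 : 0 < sph (size (ray None n)) * sph (size (v n)) by rewrite mulr_gt0
  ?sph_gt0.
suff : sph (tdist (ray None n) (v n)) / (sph (size (ray None n)) * sph (size (v
  n))) <= 7 / 5 by lra.
rewrite ler_pdivrMr //; apply: le_trans (sph_add_le _ _).
by rewrite sph_le // tdist_le.
Qed.

(** * The lifted group *)

Section Lift.
Context (X : (word -> word) -> Prop).
Context (stX : simply_transitive X).

(** All isometries extending an element of [X], rather than chosen extensions: the group laws are
    then immediate, and uniqueness is [lift_eq]. *)
Definition lift_group : set (hball E -> hball E) :=
  [set g | Isom ip g /\ exists2 f, X f & forall v, g (p v) = p (f v)].

Lemma lift_exists v : exists g, lift_group g /\ g (origin E) = p v.
Proof.
have [f Xf fv] := st_trans stX v; have [g ig gp] :=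
  tree_aut_isometry (st_aut stX Xf).
exists g; split; last by rewrite -p_root gp fv.
by split=> //; exists f.
Qed.

Lemma lift_vertex g : lift_group g -> exists v, g (origin E) = p v.
Proof. by move=> [_ [f _ gp]]; exists (f tree_root); rewrite -p_root gp. Qed.

Lemma lift_eq g g' : lift_group g -> lift_group g' ->
  g (origin E) = g' (origin E) -> g = g'.
Proof.
move=> [ig [f Xf gp]] [ig' [f' Xf' gp']]; rewrite -p_root gp gp' => /p_inj E0.
have ff := st_free stX Xf Xf' E0.
apply: isometry_eq => //.
  by exists f; split=> //; case: (st_aut stX Xf).
by move=> v; rewrite gp gp' ff.
Qed.

Lemma lift_isom_group : isom_group ip lift_group.
Proof.
split.
- by move=> g [].
- split; first by split=> //; exists id.
  by exists id => //; exact: st_id stX.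
- move=> g h [[bg ig] [f Xf gp]] [[bh ih] [f' Xf' hp]]; split.
    by split=> [|x y /=]; [exact: bij_comp|rewrite ig ih].
  by exists (f \o f') => [|v /=]; [exact: st_comp stX _ _ Xf Xf'|rewrite hp gp].
- move=> g [[[h gh hg] ig] [f Xf gp]]; exists h => //.
  have [f' [Xf' ff' f'f]] := st_inv stX Xf; split.
    by split=> [|x y]; [exists g|rewrite -ig !hg].
  by exists f' => // v; rewrite -{1}[v]f'f -gp gh.
Qed.

Lemma lift_limit_set : limit_set lift_group = tree_limit_set.
Proof.
apply/seteqP; split=> xi [xi1].
  move=> [g gG gxi]; split=> //.
  have [v vP] := choice (fun n => lift_vertex (gG n)).
  exists v; move: gxi; apply: cvg_trans.
  by under eq_fun do rewrite -vP; exact: cvg_refl.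
move=> [v vxi]; split=> //.
have [g gP] := choice (fun n => lift_exists (v n)).
exists g => [n|]; first by case: (gP n).
by under eq_fun do rewrite (gP _).2.
Qed.

(** cosh d <= e^d for d >= 0, so an orbit point p v within distance r has sph |v| <= e^r, which
    bounds |v|. *)
Lemma lift_strongly_discrete : strongly_discrete ip lift_group.
Proof.
move=> r r0; have [N NP] := sph_unbounded (expR r).
have [g gP] := choice lift_exists.
apply: (@sub_finite_set _ _ (g @` [set v : word | (size v <= N)%N])); last first.
  exact/finite_image/finite_words.
move=> h [Gh hr]; have [v hv] := lift_vertex Gh.
exists v; last by apply: lift_eq; [case: (gP v)|by []|rewrite (gP v).2 hv].
rewrite /= leqNgt; apply/negP => Nv; move: hr; rewrite hv => hr.
have d0 : 0 <= hdist ip (origin E) (p v).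
  by rewrite hdistE acosh_ge0 // hratio_ge1 // hball_ip_lt1.
have : ch (hdist ip (origin E) (p v)) = sph (size v).
  by rewrite ch_hdist -p_root hratio_p tdist0s.
have e1 : expR (hdist ip (origin E) (p v)) <= expR r by rewrite ler_expR.
have e2 : expR (- hdist ip (origin E) (p v)) <= expR (hdist ip (origin E) (p v)).
  by rewrite ler_expR; lra.
by rewrite /ch; have := sph_le (ltnW Nv); lra.
Qed.

Lemma lift_nonelementary : nonelementary lift_group.
Proof.
have [r rP] := choice ray_end_exists.
have rN x y : x != y -> r x != r y.
  move=> xy; apply/eqP => EQ; have := ray_end_ip xy (rP x) (rP y).
  by rewrite EQ (ray_end_norm (rP y)); lra.
exists (r None), (r (Some true)), (r (Some false)); rewrite !lift_limit_set.
by split; split; rewrite ?rN //; exact: ray_end_limit.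
Qed.

Lemma lift_second_kind : second_kind lift_group.
Proof. by rewrite /second_kind lift_limit_set; exact: tree_limit_set_neq. Qed.

(** * Coboundedness on the convex hull *)

Lemma convex_hull_half_space (x : hball E) (w : E) (t : R) (N : nat) :
  convex_hull ip lift_group x ->
  (forall v : word, (N <= size v)%N -> ip (P v) w <= t) ->
  ip (set_val x) w <= t.
Proof.
move=> hx vt; apply: (hx (half_space w t)); split.
- exact: closed_half_space.
- exact: hconvex_half_space.
rewrite lift_limit_set => xi [xi1 [v vxi]].
apply: (@closed_cvg _ _ \oo _ (fun n =>
  P (v n)) (closure (set_val @` half_space w t))).
- exact: closed_closure.
(* As |p v|^2 = 1 - sph(|v|)^-2, vertices converging to the boundary eventually have size at least
   [N], so finitely many vertices may violate the inequality. *)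
- have n0 : 0 < (sph N)^-1 ^+ 2 by rewrite exprn_gt0 // invr_gt0 sph_gt0.
  have /cvgrPdist_lt /(_ _ n0) := ip_cvg vxi vxi.
  apply: filterS => n; rewrite ipxx xi1 expr1n p_ipxx opprB addrCA subrr addr0.
  rewrite ger0_norm ?sqr_ge0 // => vN; apply: subset_closure;
    exists (p (v n)) => //.
  apply: vt; rewrite leqNgt; apply/negP => /ltnW /sph_le.
  rewrite leNgt => /negP; apply.
  move: vN; rewrite ltr_pXn2r ?nnegrE ?invr_ge0 ?ltW ?sph_gt0 //.
  by rewrite ltf_pV2 // posrE sph_gt0.
- exact: vxi.
Qed.

(** Minus the Lorentz product of (1, x) with the lift of [v], that is [dgamma x] times cosh of the
    distance; it is affine in [x]. *)
Let height (x : hball E) (v : word) : R :=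
  sph (size v) * (1 - ip (set_val x) (P v)).

Lemma height_p (u v : word) : sph (size u) * height (p u) v = sph (tdist u v).
Proof. by rewrite /height mulrA p_gram. Qed.

Lemma hratio_height x v : hratio (set_val x) (P v) =
  height x v / dgamma (set_val x).
Proof. by rewrite /hratio dgamma_p invfM invrK mulrA mulrC mulrA. Qed.

Lemma height_ge x v : dgamma (set_val x) <= height x v.
Proof.
have x1 := hball_ip_lt1 x; have := hratio_ge1 x1 (hball_ip_lt1 (p v)).
by rewrite hratio_height ler_pdivlMr ?dgamma_gt0 // mul1r.
Qed.

Lemma height_gt0 x v : 0 < height x v.
Proof. exact: lt_le_trans (dgamma_gt0 (hball_ip_lt1 x)) (height_ge x v). Qed.

(** A near-minimum of the positive infimum suffices: [height_growth] only needs 8/9 to exceed the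
    2/3 of its convexity inequality. *)
Lemma height_near_min x : exists v0, forall v, height x v0 <= 9 / 8 * height x v.
Proof.
pose A := range (height x); have dx := dgamma_gt0 (hball_ip_lt1 x).
have lbA : lbound A (dgamma (set_val x)) by move=> _ [v _ <-]; exact: height_ge.
have infA : has_inf A by split; [exists (height x tree_root);
  exists tree_root|exists (dgamma (set_val x))].
have i0 : 0 < inf A.
  by apply: lt_le_trans dx _; apply: lb_le_inf lbA; case: infA.
have [|_ [v0 _ <-] v0P] := @inf_adherent _ A (inf A / 8) _ infA.
  by rewrite divr_gt0.
exists v0 => v; have : inf A <= height x v.
  by apply: ge_inf; [case: infA|exists v].
by lra.
Qed.

(* If v0 nearly minimizes the height, stepping from v0 towards v cannot decrease
   it much; as half-spaces containing the limit set contain the hull, the convexity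
   inequality between the vertices v0, a, v holds for the height. *)
Lemma height_growth x v0 : convex_hull ip lift_group x ->
  (forall v, height x v0 <= 9 / 8 * height x v) ->
  forall v, v != v0 -> 8 / 81 * sph (tdist v v0) * height x v0 <= height x v.
Proof.
move=> hx min_v0 v; rewrite eq_sym => vv0; have [a aP] := tdist_toward vv0.
have D0 : (0 < tdist v0 v)%N.
  rewrite lt0n; apply: contra_neq vv0 => /tdist_eq0; exact: letters_inj.
set D := tdist v0 v in D0 aP; pose k := (sph D.-1)^-1.
have sD := sph_gt0 D.-1.
have k0 : 0 < k by rewrite invr_gt0.
have kK : k * sph D.-1 = 1 by rewrite mulVf // lt0r_neq0.
(* On the side of [a] the first term suffices, because [sph] grows by at least 3/2 per step.
   Elsewhere [v0] lies between [w] and [v], and [sph_mul_le] bounds the left side by the last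
   term. *)
have tree_ineq (w : word) : sph (tdist w a) <= 2 / 3 * sph (tdist w v0) +
  k * sph (tdist w v).
  case: (aP w) => [->|[-> ->]].
    have := sphS_ge (tdist w a); have := mulr_gt0 k0 (sph_gt0 (tdist w v)); lra.
  have := sph_mul_le (tdist w v0).+1 D.-1; rewrite addSnnS prednK // => H.
  have : k * (sph (tdist w v0).+1 * sph D.-1) <= k * sph (tdist w v0 +
    D) by rewrite ler_pM2l.
  by rewrite mulrCA kK mulr1; have := sph_gt0 (tdist w v0); lra.
(* [W] and [T] rewrite the inequality as a half-space in the variable [y]. *)
pose W := (- sph (size a)) *: P a + (2 / 3 * sph (size v0)) *: P v0 +
  (k * sph (size v)) *: P v.
pose T := - sph (size a) + 2 / 3 * sph (size v0) + k * sph (size v).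
have WT (y : hball E) : ip (set_val y) W - T =
    height y a - 2 / 3 * height y v0 - k * height y v.
  by rewrite /W /T /height !ipE; lra.
have : ip (set_val x) W <= T.
  apply: (convex_hull_half_space (N := 0) hx) => w _.
  rewrite -subr_le0 WT -(pmulr_rle0 _ (sph_gt0 (size w))) !mulrBr.
  rewrite [_ * (_ * height _ v0)]mulrCA [_ * (k * _)]mulrCA !height_p.
  by have := tree_ineq w; lra.
rewrite -subr_le0 WT => H; have := min_v0 a => Ha.
have v00 := height_gt0 x v0.
have H1 : 2 / 9 * height x v0 <= k * height x v by lra.
have H2 : sph D.-1 * (2 / 9 * height x v0) <= height x v.
  have -> : height x v = sph D.-1 * (k * height x v).
    by rewrite mulrA (mulrC _ k) kK mul1r.
  by rewrite ler_pM2l.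
(* 8/81 is 2/9 = 8/9 - 2/3 times 4/9, the loss from D - 1 to D. *)
have sDD : sph D <= 9 / 4 * sph D.-1 by rewrite -{1}(prednK D0) sphS_le.
rewrite tdistC -/D; apply: le_trans H2.
have : sph D * height x v0 <= 9 / 4 * sph D.-1 * height x v0 by rewrite ler_pM2r.
by lra.
Qed.

(** [height_growth] is an inequality 1 - ip y x >= c (1 - ip y (p v0)) at the vertices y other than
    p v0, so it holds on the hull, in particular at y = x. There it reads 1 - |x|^2 >= 8/81 h0^2, so
    cosh^2 of the distance is at most 81/8 < 16. *)
Lemma convex_hull_near_vertex x : convex_hull ip lift_group x ->
  exists v, hdist ip (p v) x < acosh 4.
Proof.
move=> hx; have [v0 min_v0] := height_near_min x.
have grow := height_growth hx min_v0.
exists v0; set h0 := height x v0 in grow; have h00 : 0 < h0 := height_gt0 x v0.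
have x1 := hball_ip_lt1 x; have dx := dgamma_gt0 x1; have dxx := dgamma_sqr x1.
pose c := 8 / 81 * h0 * sph (size v0).
have : ip (set_val x) (set_val x - c *: P v0) <= 1 - c.
  apply: (convex_hull_half_space (N := (size v0).+1) hx) => v vN.
  have vv0 : v != v0 by apply: contraTneq vN => ->; rewrite ltnn.
  have sv := sph_gt0 (size v).
  have := grow v vv0; rewrite -(p_gram v v0) /height -/h0.
  rewrite !ipE (ipC (P v) (P v0)) (ipC (P v) (set_val x)) => H.
  rewrite -(ler_pM2l sv).
  by rewrite /c; move: H; lra.
rewrite !ipE => H; have {}H : 8 / 81 * h0 ^+ 2 <= dgamma (set_val x) ^+ 2.
  by rewrite dxx; move: H; rewrite /c /h0 /height; lra.
rewrite hdistE; apply: acosh_lt; first by rewrite hratio_ge1 // hball_ip_lt1.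
have -> : hratio (P v0) (set_val x) = hratio (set_val x) (P v0).
  by rewrite /hratio ipC (mulrC (dgamma (P v0))).
rewrite hratio_height -/h0 ltr_pdivrMr // -(@ltr_pXn2r _ 2) //; last 2 first.
- by rewrite nnegrE ltW.
- by rewrite nnegrE mulr_ge0 // ltW.
have -> : (4 * dgamma (set_val x)) ^+ 2 = 16 * dgamma (set_val x) ^+ 2 by lra.
move: H (exprn_gt0 2 dx).
by move: (h0 ^+ 2) (dgamma (set_val x) ^+ 2) => A B; lra.
Qed.

Lemma lift_convex_cobounded : convex_cobounded ip lift_group.
Proof.
split; [exact: lift_strongly_discrete|exact: lift_nonelementary|].
exists (acosh 4 + 1).
  have : 0 <= acosh 4 :> R by apply: acosh_ge0; lra.
  by lra.
move=> x /convex_hull_near_vertex[v xv].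
have [g [Gg gv]] := lift_exists v.
have [_ _ _ ginv] := lift_isom_group; have [h Gh [gh hg]] := ginv g Gg.
exists g => //; exists (h x); last exact: hg.
have [[_ ig] _] := Gg; rewrite /= -ig hg gv; by apply: lt_trans xv _; lra.
Qed.

(** * Nonplanarity *)

Definition child1 (v : word) : word := step (next_letter (head None v)) v.
Definition child2 (v : word) : word :=
  step (next_letter (next_letter (head None v))) v.
(** At the root [head] returns its default, and this is the neighbour along [None]. Hence the
    assumption [v != tree_root] below; [harmonic_children] holds everywhere, as the three labels are
    distinct in any case. *)
Definition parent (v : word) : word := step (head None v) v.

Lemma size_children v : v != tree_root ->
  size (child1 v) = (size v).+1 /\ size (child2 v) = (size v).+1.
Proof.
by case: v => [[|[[]|] s] rs]; rewrite -val_eqE.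
Qed.

Lemma children_neq_root v : v != tree_root ->
  child1 v != tree_root /\ child2 v != tree_root.
Proof.
by move=> /size_children[c1 c2]; split; apply/eqP => EQ; [move: c1|move: c2];
  rewrite EQ.
Qed.

Lemma parentK v : v != tree_root -> parent (child1 v) = v /\ parent (child2 v) = v.
Proof.
move=> vN; suff [h1 h2] : head None (child1 v) = next_letter (head None v) /\
    head None (child2 v) = next_letter (next_letter (head None v)).
  by rewrite /parent h1 h2 !stepK.
by case: v vN => [[|[[]|] s] rs]; rewrite -val_eqE.
Qed.

Let Q (v : word) : E := sph (size v) *: P v.

Lemma harmonic_children v : Q (child1 v) + Q (child2 v) + Q (parent v) =
  (9 / 2) *: Q v.
Proof.
rewrite -(p_harmonic v) /child1 /child2 /parent.
by case: (head None v) => [[]|] /=; apply: ip_ext => z; rewrite !ipDl; lra.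
Qed.

(** Written as iterated midpoints because totally geodesic sets are stable under midpoints. *)
Fixpoint descent_mean (Z : word -> E) (n : nat) (v : word) : E :=
  if n is m.+1 then
    2^-1 *: (descent_mean Z m (child1 v) + descent_mean Z m (child2 v))
  else Z v.

Lemma descent_mean_scale Z c n v :
  descent_mean (fun w => c *: Z w) n v = c *: descent_mean Z n v.
Proof.
elim: n v => // n IH v /=; rewrite !IH -scalerDr !scalerA.
by rewrite mulrC.
Qed.

Lemma descent_mean_dist Z Z' (e : R) n v : v != tree_root ->
  (forall w : word, size w = (n + size v)%N -> `|Z w - Z' w| <= e) ->
  `|descent_mean Z n v - descent_mean Z' n v| <= e.
Proof.
elim: n v => [|n IH] v vN H /=; first exact: H.
have [s1 s2] := size_children vN; have [n1 n2] := children_neq_root vN.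
have H1 := IH _ n1; have H2 := IH _ n2.
rewrite -scalerBr opprD addrACA normrZ gtr0_norm; last by lra.
have {}H1 : `|descent_mean Z n (child1 v) - descent_mean Z' n (child1 v)| <= e.
  by apply: H1 => w; rewrite s1 -addSnnS; exact: H.
have {}H2 : `|descent_mean Z n (child2 v) - descent_mean Z' n (child2 v)| <= e.
  by apply: H2 => w; rewrite s2 -addSnnS; exact: H.
by have := ler_normD (descent_mean Z n (child1 v) - descent_mean Z' n (child1 v))
  (descent_mean Z n (child2 v) - descent_mean Z' n (child2 v)); lra.
Qed.

(** Harmonicity eliminates the children level by level. The coefficients depend on [n] only, so they
    factor out of the sum over the neighbours of the root. *)
Lemma descent_mean_Q n : exists a b : R, forall v, v != tree_root ->
  descent_mean Q n v = a *: Q v + b *: Q (parent v).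
Proof.
elim: n => [|n [a [b IH]]].
  by exists 1, 0 => v _; rewrite scale1r scale0r addr0.
exists (2^-1 * (9 / 2 * a) + b), (- (2^-1 * a)) => v vN.
have [n1 n2] := children_neq_root vN; have [p1 p2] := parentK vN.
rewrite /= !IH // p1 p2; have := harmonic_children v.
move: (Q (child1 v)) (Q (child2 v)) (Q (parent v)) (Q v) => x y z w H.
apply: ip_ext => u; have := congr1 (ip^~ u) H; rewrite !ipE => {}H.
by apply: (eq_lincomb (c := 2^-1 * a) H); lra.
Qed.

Lemma Q_root : Q tree_root = 0.
Proof. by rewrite /Q p_root scaler0. Qed.

Lemma descent_mean_sum0 n :
  descent_mean Q n (step None tree_root) +
  descent_mean Q n (step (Some true) tree_root) +
  descent_mean Q n (step (Some false) tree_root) = 0.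
Proof.
have [a [b H]] := descent_mean_Q n.
have par x : parent (step x tree_root) = tree_root.
  by rewrite /parent letters_step /= stepK.
have HQ : Q (step None tree_root) + Q (step (Some true) tree_root) +
    Q (step (Some false) tree_root) = 0.
  by rewrite -[RHS](scaler0 _ (9 / 2)) -Q_root; exact: p_harmonic.
by rewrite !H // !par Q_root scaler0 !addr0 -!(scalerDr a) HQ scaler0.
Qed.

(* If g_w is the element carrying the origin to p w, then g_w x - p w tends to 0
   as |w| grows, while by harmonicity the average of p over a sphere of T about
   the root is 0; so averages of the g_w x, which lie in S, tend to the origin. *)
Lemma no_invariant_totally_geodesic (S : set (hball E)) : S !=set0 ->
  totally_geodesic ip S -> (forall g, lift_group g -> g @` S = S) -> S = setT.
Proof.
move=> [x Sx] Sgeo Sinv; have [g gP] := choice lift_exists.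
have Sg v y : S y -> S (g v y).
  by move=> Sy; rewrite -(Sinv _ (gP v).1); exists y.
pose Y v : E := set_val (g v x).
have dx := dgamma_gt0 (hball_ip_lt1 x).
pose C := (dgamma (set_val x))^-1; have C0 : 0 < C by rewrite invr_gt0.
(* Both points lie in the ball, so |Y - P|^2 <= 2 (1 - ip Y P); the right side is controlled by C =
   cosh d(x, 0), the same for all [v]. *)
have YP v : `|Y v - P v| ^+ 2 <= 2 * C * (sph (size v))^-1.
  have [[_ ig] _] := (gP v).1; have y1 := hball_ip_lt1 (g v x).
  have : hratio (set_val (g v x)) (P v) = C.
    rewrite -(gP v).2; transitivity (hratio (set_val x) (set_val (origin E))).
      by apply/hdist_inj; rewrite ig.
    by rewrite /hratio /= ip0r subr0 dgamma0 mulr1 div1r.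
  rewrite /hratio dgamma_p => H.
  have dy := dgamma_gt0 y1; have s0 := sph_gt0 (size v).
  have i0 : 0 < (sph (size v))^-1 by rewrite invr_gt0.
  have : 1 - ip (Y v) (P v) = C * (dgamma (Y v) * (sph (size v))^-1).
    by rewrite -H divfK // mulf_neq0 // lt0r_neq0.
  have : C * (dgamma (Y v) * (sph (size v))^-1) <= C * (sph (size v))^-1.
    by rewrite ler_pM2l // ler_piMl ?(ltW i0) // dgamma_le1.
  rewrite -ipxx ip_subxx; have := hball_ip_lt1 (p v); move: y1; rewrite -/(Y v).
  by lra.
have Smean n v : exists2 z, S z & set_val z = descent_mean Y n v.
  elim: n v => [|n IH] v; first by exists (g v x) => //; exact: Sg.
  have [z1 S1 E1] := IH (child1 v); have [z2 S2 E2] := IH (child2 v).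
  by have [z Sz zE] := totally_geodesic_mid Sgeo S1 S2; exists z;
    rewrite // zE E1 E2.
have S0 : S (origin E).
  apply: (closed_hball_approx Sgeo.1) => e e0.
  have [n nP] := sph_unbounded (2 * C / (e / 2) ^+ 2).
  have [z1 S1 E1] := Smean n (step None tree_root).
  have [z2 S2 E2] := Smean n (step (Some true) tree_root).
  have [z3 S3 E3] := Smean n (step (Some false) tree_root).
  have [m Sm mE] := totally_geodesic_mid Sgeo S1 S2.
  (* Weight 2/3 on the midpoint of two points gives the barycentre of the three. *)
  have [||| z Sz zE] := @totally_geodesic_convex S Sgeo m z3 (2 / 3) (1 / 3) Sm S3.
  - by lra.
  - by lra.
  - by lra.
  exists z => //; rewrite sub0r normrN.
  (* The averaged vertices have size n + 1, since the descent starts at the neighbours of the root;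
     there [c] turns [Q] into [p]. *)
  pose c := (sph n.+1)^-1.
  have close x' : `|descent_mean Y n (step x' tree_root) - c *: descent_mean Q n
    (step x' tree_root)| <= e / 2.
    rewrite -descent_mean_scale; apply: descent_mean_dist => // w.
    rewrite [size _]/= addn1 => wn.
    have -> : c *: Q w = P w.
      by rewrite /Q wn scalerA mulVf ?scale1r // sph_neq0.
    rewrite -(@ler_pXn2r _ 2) ?nnegrE ?divr_ge0 ?(ltW e0) //.
    apply: le_trans (YP w) _; rewrite wn.
    have e2 : 0 < (e / 2) ^+ 2 by rewrite exprn_gt0 // divr_gt0.
    rewrite ler_pdivrMr ?sph_gt0 // [leRHS]mulrC -ler_pdivrMr //.
    by apply: le_trans (ltW nP) _; rewrite sph_le.
  have := descent_mean_sum0 n; have := close None; have := close (Some true);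
    have := close (Some false).
  rewrite zE mE E1 E2 E3.
  move: (descent_mean Y n _) (descent_mean Y n _) (descent_mean Y n _) => y1 y2 y3.
  move: (descent_mean Q n _) (descent_mean Q n _) (descent_mean Q n _) => q1 q2 q3.
  move=> H1 H2 H3 q0.
  have -> : (2 / 3) *: (2^-1 *: (y1 + y2)) + (1 / 3) *: y3 =
      3^-1 *: ((y3 - c *: q3) + (y2 - c *: q2) + (y1 - c *: q1)).
    apply: ip_ext => u; have := congr1 (ip^~ u) q0; rewrite !ipE => q0u.
    by apply: (eq_lincomb (c := 3^-1 * c) q0u); lra.
  rewrite normrZ gtr0_norm; last by lra.
  have := ler_normD (y3 - c *: q3 + (y2 - c *: q2)) (y1 - c *: q1).
  have := ler_normD (y3 - c *: q3) (y2 - c *: q2).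
  by lra.
apply: (totally_geodesic_full Sgeo S0 (p := p)) => // v.
by rewrite -(gP v).2; exact: Sg.
Qed.

(* The horofunction beta of a fixed xi is multiplied by a constant under each g,
   which is 1 when g is an involution; hence beta is constant on the vertices. *)
Lemma no_fixed_boundary_point (xi : E) : hboundary E xi ->
  ~ forall g, lift_group g -> boundary_map g xi xi.
Proof.
rewrite /hboundary /= => xi1 fix_xi; have xixi : ip xi xi =
  1 by rewrite ipxx xi1 expr1n.
pose r (n : nat) : R := 1 - n.+2%:R^-1.
have r01 n : 0 <= r n < 1.
  have n0 : 0 < n.+2%:R^-1 :> R by rewrite invr_gt0 ltr0n.
  have n1 : n.+2%:R^-1 <= 1 :> R by rewrite invf_le1 ?ltr0n // ler1n.
  by rewrite /r; move: (n.+2%:R^-1) n0 n1 => i *; apply/andP; split; lra.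
have r1 n : ip (r n *: xi) (r n *: xi) < 1.
  rewrite !ipE xixi; have := r01 n; case/andP => r0 r1.
  by have : r n * r n <= r n * 1 by [rewrite ler_wpM2l // ltW]; lra.
pose u n := mkhball (r1 n).
have uxi : set_val (u n) @[n --> \oo] --> xi.
  apply: (cvg_norm_bound (b := fun n => n.+1%:R^-1)) => [n|];
    last exact: cvg_harmonic.
  rewrite set_val_mkhball -{1}[xi]scale1r -scalerBl normrZ xi1 mulr1 /r opprB
    addrCA subrr addr0.
  rewrite ger0_norm ?invr_ge0 // lef_pV2 ?posrE ?ltr0n // ler_nat.
  exact: leqnSn.
pose beta v := sph (size (letters v)) * (1 - ip xi (P v)).
have beta0 v : 0 < beta v.
  rewrite mulr_gt0 ?sph_gt0 // subr_gt0 ipC ip_lt1 ?xixi ?hball_ip_lt1 //.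
have hcvg w v : set_val (w n) @[n --> \oo] --> xi -> height (w n) v @[n --> \oo]
  --> beta v.
  move=> wxi; apply: cvgM; first exact: cvg_cst.
  apply: cvgB; first exact: cvg_cst.
  by apply: ip_cvg => //; exact: cvg_cst.
(* beta (f v) / beta v does not depend on [v]: along [u] the ratio of heights is a quotient of two
   [dgamma] factors, and the products converge. *)
have ratio_beta f g v w : (forall v, g (p v) = p (f v)) -> lift_group g ->
    beta (f v) * beta w = beta (f w) * beta v.
  move=> gp Gg; have gu := fix_xi g Gg u uxi; have [[_ ig] _] := Gg.
  have A : height (g (u n)) (f v) * height (u n) w @[n --> \oo] --> beta (f v) *
    beta w.
    by apply: cvgM; [exact: hcvg gu|exact: hcvg uxi].
  have B : height (g (u n)) (f w) * height (u n) v @[n --> \oo] --> beta (f w) *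
    beta v.
    by apply: cvgM; [exact: hcvg gu|exact: hcvg uxi].
  apply: (cvg_unique (@norm_hausdorff _ R^o) A).
  suff -> : (fun n => height (g (u n)) (f v) * height (u n) w) =
      (fun n => height (g (u n)) (f w) * height (u n) v) by [].
  apply/funext => n /=.
  have E1 v' : height (g (u n)) (f v') / dgamma (set_val (g (u n))) =
      height (u n) v' / dgamma (set_val (u n)).
    by rewrite -!hratio_height -gp; apply/hdist_inj; rewrite ig.
  have d1 := dgamma_gt0 (hball_ip_lt1 (g (u n))); have d2 :=
    dgamma_gt0 (hball_ip_lt1 (u n)).
  have E2 v' : height (g (u n)) (f v') =
      dgamma (set_val (g (u n))) / dgamma (set_val (u n)) * height (u n) v'.
    by rewrite mulrAC -mulrA -E1 mulrC divfK // lt0r_neq0.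
  by rewrite !E2; lra.
(* Taking w = f v, the relation becomes beta (f v)^2 = beta v^2. *)
have beta_inv f : X f -> involutive f -> forall v, beta (f v) = beta v.
  move=> Xf ff v; have [g ig gp] := tree_aut_isometry (st_aut stX Xf).
  have Gg : lift_group g by split => //; exists f.
  have := ratio_beta f g v (f v) gp Gg; rewrite ff -!expr2 => /eqP.
  by rewrite eqrXn2 ?ltW ?beta0 // => /eqP.
have beta1 v : beta v = 1.
  rewrite (st_involutions stX beta_inv v) /beta p_root /= ip0r sph0.
  by lra.
(* beta = 1 gives each neighbour of the root the inner product sph 1 - 1 = 1/2 with [xi], whereas by
   harmonicity the three sum to 0. *)
have := p_harmonic tree_root; rewrite /= p_root scaler0 scaler0.
move/(congr1 (ip xi)); rewrite !ipE.
have := beta1 (step None tree_root); have := beta1 (step (Some true) tree_root).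
have := beta1 (step (Some false) tree_root); rewrite /beta /= sph1.
by lra.
Qed.

Lemma lift_nonplanar : nonplanar ip lift_group.
Proof.
split=> [[S [S0 ST Sgeo Sinv]]|[xi xi1]].
  by move/eqP: ST; apply; exact: no_invariant_totally_geodesic.
exact: no_fixed_boundary_point.
Qed.

(** Cosets of the trivial group are singletons, and a ray already provides infinitely many
    elements. *)
Lemma lift_not_finite_index : ~ finite_index [set id] lift_group.
Proof.
have [g gP] := choice (fun n => lift_exists (ray None n)).
move=> fin; apply: infinite_nat.
have coset_inj : injective (fun n => [set g n \o k | k in [set id]]).
  move=> m n mn; have : [set g n \o k | k in [set id]] (g m \o id).
    by rewrite -mn; exists id.
  move=> [_ -> gmn]; have : p (ray None m) = p (ray None n).
    by rewrite -(gP m).2 -(gP n).2; have := congr1 (@^~ (origin E)) gmn.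
  by move/p_inj/(congr1 (fun v : word => size v)); rewrite !size_ray.
apply: sub_finite_set (finite_preimage (in2W coset_inj) fin).
by move=> n _; exists (g n) => //; case: (gP n).
Qed.

End Lift.
End TreeGroup.
End Hyperbolic.

(** * The pair of groups *)

Theorem theorem4p3 (R : realType) (E : completeNormedModType R)
    (ip : E -> E -> R) (ip_inner : inner_product ip)
    (E_separable : separable E) (E_infinite : infinite_dimensional E) :
  exists G1 G2 : set (hball E -> hball E),
    [/\ isom_group ip G1, convex_cobounded ip G1, nonplanar ip G1
      & second_kind G1] /\
    [/\ isom_group ip G2, convex_cobounded ip G2, nonplanar ip G2
      & second_kind G2] /\
    [/\ limit_set G1 = limit_set G2, G1 `&` G2 = [set id]
      & ~ commensurable G1 G2].
Proof.
have [p [p_root p_gram p_harmonic p_span]] :=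
  tree_embedding ip_inner E_separable E_infinite.
have st1 := label_preserving_simply_transitive.
have st2 := twisted_simply_transitive.
pose G X := lift_group (ip := ip) p X.
have props X : simply_transitive X ->
    [/\ isom_group ip (G X), convex_cobounded ip (G X), nonplanar ip (G X)
      & second_kind (G X)].
  move=> stX; split.
  - exact: (lift_isom_group (ip := ip) p stX).
  - exact: (lift_convex_cobounded ip_inner p_root p_gram p_span stX).
  - exact: (lift_nonplanar ip_inner p_root p_gram p_harmonic p_span stX).
  - exact: (lift_second_kind ip_inner p_root p_gram p_span stX).
have meet : G label_preserving `&` G twisted = [set id].
  apply/seteqP; split=> [g [G1g [_ [f' tf' gp']]]|_ ->].
    have [_ [f cf gp]] := G1g.
    have ff : f = f'.
      by apply/funext => v; apply: (p_inj ip_inner p_gram); rewrite -gp gp'.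
    have fid := label_preserving_twisted cf (eq_ind_r twisted tf' ff).
    have [_ Gid _ _] := lift_isom_group (ip := ip) p st1.
    apply: (lift_eq ip_inner p_root p_gram p_span st1 G1g Gid).
    by rewrite -p_root gp fid.
  split.
    by case: (lift_isom_group (ip := ip) p st1).
  by case: (lift_isom_group (ip := ip) p st2).
exists (G label_preserving), (G twisted).
split; [exact: props|split; [exact: props|split=> //]].
  by rewrite /G !(lift_limit_set ip_inner p_root p_gram p_span).
rewrite /commensurable meet => -[fin _].
exact: (lift_not_finite_index ip_inner p_root p_gram p_span st1 fin).
Qed.
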